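(* Let $n,p\ge 1$ and $\gamma,\mu>0$ with $p/n\le\gamma$. Let $\rho:\mathbb{R}\to\mathbb{R}$ be convex with a unique minimizer at $0$, continuously differentiable, with $\psi=\rho'$ $1$-Lipschitz. Let $\Sigma\in\mathbb{R}^{p\times p}$ be an invertible covariance matrix and let $g:\mathbb{R}^p\to\mathbb{R}$ be such that $b\mapsto g(b)-(\mu/2)b^\top\Sigma b$ is convex. (The design $X$ has iid $N(0,\Sigma)$ rows and the noise $\varepsilon=y-X\beta^*$ is independent of $X$ with continuous distribution.) Let $$\hat\beta(y,X)=\operatorname*{argmin}_{b\in\mathbb{R}^p}\ \frac1n\sum_{i=1}^n\rho(y_i-x_i^\top b)+g(b).$$ Then for almost every $(y,X)\in\mathbb{R}^n\times\mathbb{R}^{n\times p}$ the map $(y,X)\mapsto\hat\beta(y,X)$ is differentiable at $(y,X)$ and there exists a matrix $\hat A\in\mathbb{R}^{p\times p}$ depending on $(y,X)$ with $\|\Sigma^{1/2}\hat A\Sigma^{1/2}\|_{op}\le (n\mu)^{-1}$ such that, for all $i\in\{1,\dots,n\}$ and $j\in\{1,\dots,p\}$, with $r_i=y_i-x_i^\top\hat\beta$, $$\frac{\partial\hat\beta}{\partial y_i}(y,X)=\hat A X^\top e_i\,\psi'(r_i),\qquad \frac{\partial\hat\beta}{\partial x_{ij}}(y,X)=\hat A e_j\,\psi(r_i)-\hat A X^\top e_i\,\psi'(r_i)\,\hat\beta_j,$$ where in each formula $e_i\in\mathbb{R}^n$ and $e_j\in\mathbb{R}^p$ are canonical basis vectors.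 Furthermore, the quantities $$\mathrm{df}:=\operatorname{tr}\Big[X\frac{\partial\hat\beta}{\partial y}\Big]=\operatorname{tr}\big[X\hat AX^\top\operatorname{diag}\{\psi'(r)\}\big],$$ $$V:=\operatorname{diag}\{\psi'(r)\}\Big(I_n-X\frac{\partial\hat\beta}{\partial y}\Big)=\operatorname{diag}\{\psi'(r)\}-\operatorname{diag}\{\psi'(r)\}X\hat AX^\top\operatorname{diag}\{\psi'(r)\}$$ satisfy $0\le \mathrm{df}\le n$ and $0\le\operatorname{tr}[V]\le n$.
   Context: $X\in\mathbb{R}^{n\times p}$ has rows $x_1^\top,\dots,x_n^\top$ and entries $x_{ij}$; $y=(y_1,\dots,y_n)\in\mathbb{R}^n$. ''Almost every'' is with respect to Lebesgue measure on $\mathbb{R}^n\times\mathbb{R}^{n\times p}$. $\partial\hat\beta/\partial y\in\mathbb{R}^{p\times n}$ is the Jacobian of $\hat\beta$ in $y$ for fixed $X$. $\psi'$ is the derivative of $\psi$ (which exists almost everywhere since $\psi$ is Lipschitz), with the convention $\psi'(u)=0$ where $\psi$ is not differentiable. $r=(r_1,\dots,r_n)=y-X\hat\beta$; $\psi,\psi'$ are applied to vectors componentwise. $\operatorname{diag}\{v\}$ is the diagonal matrix with diagonal $v$, and $\|\cdot\|_{op}$ is the largest singular value. *)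

(* Defs.v *)
From HB Require Import structures.
From mathcomp Require Import all_boot all_order all_algebra.
From mathcomp Require Import all_classical all_reals all_analysis.

Set Implicit Arguments.
Unset Strict Implicit.
Unset Printing Implicit Defensive.

Import Order.TTheory GRing.Theory Num.Theory.
Import numFieldNormedType.Exports.

Local Open Scope classical_set_scope.
Local Open Scope ring_scope.

Section Matrices.
Variable R : realType.

Definition is_covariance (p : nat) (S : 'M[R]_p) : Prop :=
  S^T = S /\ forall v : 'cV[R]_p, 0 <= (v^T *m S *m v) 0 0.

(* The unique symmetric positive semidefinite square root; the default value 0
   is never used when [S] is symmetric positive semidefinite. *)
Definition psd_sqrt (p : nat) (S : 'M[R]_p) : 'M[R]_p :=
  xget 0 [set T : 'M[R]_p | is_covariance T /\ T *m T = S].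

Definition singular_value (m n : nat) (M : 'M[R]_(m, n)) : set R :=
  [set s | 0 <= s /\ eigenvalue (M^T *m M) (s ^+ 2)].

(* The set of singular values is finite, so the supremum is a maximum.  The
   library norm `|M| is the entrywise maximum and is not used here. *)
Definition opnorm (m n : nat) (M : 'M[R]_(m, n)) : R :=
  sup (singular_value M).

Definition diag_of (n : nat) (v : 'cV[R]_n) : 'M[R]_n := diag_mx v^T.

End Matrices.

Section LebesgueNull.
Variables (R : realType) (n p : nat).

Local Notation E := ('cV[R]_n * 'M[R]_(n, p))%type.

(* A box is encoded by its lower corner [c.1] and its upper corner [c.2]. *)
Definition box (c : E * E) : set E :=
  [set z : E | (forall i, c.1.1 i 0 < z.1 i 0 <= c.2.1 i 0) /\
           (forall i j, c.1.2 i j < z.2 i j <= c.2.2 i j)].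

Definition box_volume (c : E * E) : R :=
  (\prod_(i < n) Num.max 0 (c.2.1 i 0 - c.1.1 i 0)) *
  \prod_(i < n) \prod_(j < p) Num.max 0 (c.2.2 i j - c.1.2 i j).

(* The library has Lebesgue measure on R only; this is its usual extension to
   R^n x R^(n x p), as the outer measure generated by half-open boxes. *)
Definition lebesgue_outer (A : set E) : \bar R :=
  ereal_inf [set (\sum_(0 <= k <oo) (box_volume (c k))%:E)%E |
             c in [set c : nat -> E * E | A `<=` \bigcup_k box (c k)]].

Definition lebesgue_ae (P : E -> Prop) : Prop :=
  lebesgue_outer [set z : E | ~ P z] = 0%E.

End LebesgueNull.

Section MEstimator.
Variables (R : realType) (n p : nat).

Definition derivative_or0 (psi : R -> R) (u : R) : R :=
  if `[< derivable psi u 1 >] then derive1 psi u else 0.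

(* A minimizer chosen by [xget]; a strongly convex [f] has exactly one, so the
   choice and the default value 0 play no role there. *)
Definition argmin (f : 'cV[R]_p -> R) : 'cV[R]_p :=
  xget 0 [set b | forall b', f b <= f b'].

Definition objective (rho : R -> R) (g : 'cV[R]_p -> R)
    (y : 'cV[R]_n) (X : 'M[R]_(n, p)) (b : 'cV[R]_p) : R :=
  n%:R^-1 * \sum_(i < n) rho (y i 0 - (X *m b) i 0) + g b.

Definition betahat (rho : R -> R) (g : 'cV[R]_p -> R)
    (z : 'cV[R]_n * 'M[R]_(n, p)) : 'cV[R]_p :=
  argmin (objective rho g z.1 z.2).

Definition partial_y (f : 'cV[R]_n * 'M[R]_(n, p) -> 'cV[R]_p)
    (i : 'I_n) (z : 'cV[R]_n * 'M[R]_(n, p)) : 'cV[R]_p :=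
  'D_((delta_mx i 0, 0) : 'cV[R]_n * 'M[R]_(n, p)) f z.

Definition partial_x (f : 'cV[R]_n * 'M[R]_(n, p) -> 'cV[R]_p)
    (i : 'I_n) (j : 'I_p) (z : 'cV[R]_n * 'M[R]_(n, p)) : 'cV[R]_p :=
  'D_((0, delta_mx i j) : 'cV[R]_n * 'M[R]_(n, p)) f z.

Definition jacobian_y (f : 'cV[R]_n * 'M[R]_(n, p) -> 'cV[R]_p)
    (z : 'cV[R]_n * 'M[R]_(n, p)) : 'M[R]_(p, n) :=
  \matrix_(j < p, i < n) partial_y f i z j 0.

End MEstimator.

(* Main.v *)
Require Import Defs.
From HB Require Import structures.
From mathcomp Require Import all_boot all_order all_algebra.
From mathcomp Require Import all_classical all_reals all_analysis.
From mathcomp Require Import measurable_realfun.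
From mathcomp Require Import ring lra.

(** The objective is strongly convex, so the estimator [beta] is well defined,
    and its optimality condition is a monotone inclusion in which the data
    enter through the scores [psi (r_i)].  Adding the optimality inequalities
    of two samples [z] and [z'] eliminates [g] and leaves
    [n mu q (d) <= sum_i (psi (r'_i) (X' d)_i - psi (r_i) (X d)_i)],
    with [d = beta z' - beta z] and [q] the quadratic form of [Sigma]
    ([beta_monotone]).  Everything is read off this inequality.

    Since [psi] is nondecreasing and Lipschitz, the inequality makes [beta] and
    all the scores Lipschitz on bounded sets ([beta_lip], [beta_lip_ball]).  By
    the Rademacher theorem ([rademacher_local]) they are all differentiable at
    almost every [z].  At such a [z] the chain rule for [psi (r_i)] holds with
    the convention [psi' = 0] off the differentiability points of [psi]: if the
    derivative of [r_i] along a direction is nonzero then [r_i] sweeps a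
    neighbourhood of its value, so [psi] inherits a derivative from the score;
    if it vanishes, so does that of the score ([chain_or0]).

    Divided by the squared step, the inequality becomes in the limit
    [n mu q (b') + sum_i psi'(r_i) (X b')_i ^ 2 <= b'^T w]
    for the derivative [b'] of [beta] along a direction, where [w] is the
    vector [forcing] of that direction ([dbeta_energy]).  Hence [b'] vanishes
    with [w], so that [b' = A w] for a matrix [A].  Composing [A] with the
    projection onto the possible [w] that is orthogonal for the inverse of
    [Sigma] gives the operator norm bound ([weighted_factor_opnorm]).  Along
    [y_i] the inequality reads [psi'(r_i) a ^ 2 <= psi'(r_i) a] for the
    diagonal entry [a] of [X J], which therefore lies in [0, 1]
    ([leverage_itv]); both trace bounds follow.

    The Rademacher theorem is proved for the outer measure generated by boxes.
    Caratheodory's construction turns it into a translation invariant measure.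
    Averaging over translations along a vector [v] and exchanging the integrals
    shows that a Borel set is null as soon as its traces on all lines
    parallel to [v] are null ([null_of_null_lines]).  On a line, a Lipschitz
    function is an integral up to a linear term, by Radon-Nikodym, and is
    differentiable almost everywhere ([lipschitz_ae_derivable]); so directional
    derivatives exist almost everywhere.  Where they fail to be additive, the
    points with nearly a given slope leave holes of proportional size at
    arbitrarily small scales, and such a porous set is null by the Lebesgue
    density theorem ([porous_negligible], [ae_directional_additive]).
    Additivity on rational directions and the Lipschitz bound then give a
    Frechet derivative ([rational_linear_differentiable]). *)

Set Implicit Arguments.
Unset Strict Implicit.
Unset Printing Implicit Defensive.

Import Order.TTheory GRing.Theory Num.Theory.
Import numFieldNormedType.Exports.

Local Open Scope classical_set_scope.
Local Open Scope ring_scope.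

(** * The Lebesgue measure generated by boxes, and null sets along lines *)

Section Entries.
Context {R : realType} {n p : nat}.

Local Notation E := ('cV[R]_n * 'M[R]_(n, p))%type.
Local Notation I := ('I_n + 'I_n * 'I_p)%type.

Definition entry (z : E) (k : I) : R :=
  match k with inl i => z.1 i 0 | inr ij => z.2 ij.1 ij.2 end.

Definition of_entry (f : I -> R) : E :=
  (\col_i f (inl i), \matrix_(i, j) f (inr (i, j))).

Lemma of_entryK f k : entry (of_entry f) k = f k.
Proof. by case: k => [i|[i j]]; rewrite /= mxE. Qed.

Lemma entryP (z w : E) : entry z =1 entry w -> z = w.
Proof.
move: z w => [y X] [y' X'] /= h; congr pair; apply/matrixP => i j.
  by rewrite ord1; exact: (h (inl i)).
exact: (h (inr (i, j))).
Qed.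

Lemma entryD z w k : entry (z + w) k = entry z k + entry w k.
Proof. by case: k => [i|[i j]]; rewrite /= mxE. Qed.

Lemma entryB z w k : entry (z - w) k = entry z k - entry w k.
Proof. by case: k => [i|[i j]]; rewrite /= !mxE. Qed.

Lemma entryZ a z k : entry (a *: z) k = a * entry z k.
Proof. by case: k => [i|[i j]]; rewrite /= mxE. Qed.

Lemma entry0 k : entry 0 k = 0.
Proof. by case: k => [i|[i j]]; rewrite /= mxE. Qed.

Lemma boxE (c : E * E) :
  box c = [set z | forall k, entry c.1 k < entry z k <= entry c.2 k].
Proof.
apply/seteqP; split => z /= => [[h1 h2] [i|[i j]]//=|h]; split => [i|i j].
  exact: (h (inl i)).
exact: (h (inr (i, j))).
Qed.

Lemma box_volumeE (c : E * E) :
  box_volume c = \prod_k Num.max 0 (entry c.2 k - entry c.1 k).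
Proof. by rewrite big_sumType /=; congr (_ * _); rewrite pair_bigA. Qed.

Lemma box_volume_ge0 (c : E * E) : 0 <= box_volume c.
Proof. by rewrite box_volumeE prodr_ge0// => k _; rewrite le_max lexx. Qed.

Lemma norm_entryP (z : E) r : 0 <= r ->
  reflect (forall k, `|entry z k| <= r) (`|z| <= r).
Proof.
move=> r0; apply: (iffP idP).
  rewrite prod_normE ge_max => /andP[h1 h2] [i|[i j]].
    by apply: le_trans h1; rewrite [leRHS]/Num.norm/= mx_normrE (le_bigmax _ _ (i, 0)).
  by apply: le_trans h2; rewrite [leRHS]/Num.norm/= mx_normrE (le_bigmax _ _ (i, j)).
move=> h; rewrite prod_normE ge_max; apply/andP; split.
  rewrite [leLHS]/Num.norm/= mx_normrE; apply: bigmax_le => // -[i j] _ /=.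
  by rewrite ord1; exact: (h (inl i)).
rewrite [leLHS]/Num.norm/= mx_normrE; apply: bigmax_le => // -[i j] _ /=.
exact: (h (inr (i, j))).
Qed.

Lemma entry_norm (z : E) k : `|entry z k| <= `|z|.
Proof. exact: (norm_entryP z (normr_ge0 z) (lexx _)). Qed.

End Entries.

Section OuterMeasure.
Context {R : realType} {n p : nat}.

Local Notation E := ('cV[R]_n * 'M[R]_(n, p))%type.
Local Notation I := ('I_n + 'I_n * 'I_p)%type.
Local Notation mu := (@lebesgue_outer R n p).
Local Open Scope ereal_scope.

Lemma lebesgue_outer_ge0 A : 0 <= mu A.
Proof.
apply: le_ereal_inf_tmp => _ [c _ <-]; apply: nneseries_ge0 => k _ _.
by rewrite lee_fin box_volume_ge0.
Qed.

Lemma le_lebesgue_outer : {homo mu : A B / A `<=` B >-> A <= B}.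
Proof.
move=> A B AB; apply: ereal_inf_le_tmp => _ [c Bc <-]; exists c => //.
exact: subset_trans Bc.
Qed.

Lemma lebesgue_outer_cover (A : set E) (c : nat -> E * E) :
  A `<=` \bigcup_k box (c k) -> mu A <= \sum_(0 <= k <oo) (box_volume (c k))%:E.
Proof. by move=> h; apply: ereal_inf_lbound; exists c. Qed.

(** Near-optimal covers of the [A m], with errors summing to [e], are merged
    into one cover along a bijection of [nat * nat] with [nat]. *)
Lemma lebesgue_outer_sigma_subadditive : sigma_subadditive mu.
Proof.
move=> A; have [[i ioo]|] := pselect (exists i, mu (A i) = +oo).
  rewrite (eseries_pinfty _ _ ioo) ?leey// => k _.
  by rewrite -ltNye (lt_le_trans _ (lebesgue_outer_ge0 _)).
rewrite -forallNE => Afin.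
apply/lee_addgt0Pr => e e0.
rewrite (le_trans _ (epsilon_trick _ _ (ltW e0)))//; last first.
  by move=> k; exact: lebesgue_outer_ge0.
have /choice[c cA] : forall m, exists c : nat -> E * E,
    A m `<=` \bigcup_k box (c k) /\
    \sum_(0 <= k <oo) (box_volume (c k))%:E <= mu (A m) + (e / (2 ^ m.+1)%:R)%:E.
  move=> m; have em : (0 < e / (2 ^ m.+1)%:R)%R.
    by rewrite divr_gt0// ltr0n expn_gt0.
  have fm : mu (A m) \is a fin_num.
    by rewrite ge0_fin_numE ?lebesgue_outer_ge0// ltey; apply/eqP/Afin.
  have [_ [c Ac <-] h] := lb_ereal_inf_adherent em fm.
  by exists c; split => //; exact: ltW.
have /card_esym/ppcard_eqP[f] := card_nat2.
pose d k := c (f k).1 (f k).2.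
have Ad : \bigcup_m A m `<=` \bigcup_k box (d k).
  move=> z [m _] /(cA m).1[k _ zk]; exists (f^-1%FUN (m, k)) => //.
  by rewrite /d invK ?inE.
apply: le_trans (lebesgue_outer_cover Ad) _.
have v0 (i : E * E) : 0 <= (box_volume i)%:E by rewrite lee_fin box_volume_ge0.
rewrite nneseries_esumT//.
rewrite -(reindex_esum [set: nat] [set: nat * nat] f (fun x => (box_volume (c x.1 x.2))%:E))//.
have -> : [set: nat * nat] = [set: nat] `*`` (fun=> [set: nat]) by apply/seteqP; split.
rewrite -(@esum_esum R nat nat setT (fun=> setT) (fun i j => (box_volume (c i j))%:E))//.
rewrite -(nneseries_esumT (a := fun i => \esum_(j in [set: nat]) (box_volume (c i j))%:E)); last first.
  by move=> m /=; apply: esum_ge0 => k _; exact: v0.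
apply: lee_nneseries => [m _ _|m _ /=]; first by apply: esum_ge0 => k _; exact: v0.
by rewrite -nneseries_esumT//; exact: (cA m).2.
Qed.

End OuterMeasure.

Section LebesgueMeasure.
Context {R : realType} {n p : nat}.

Local Notation E := ('cV[R]_n.+1 * 'M[R]_(n.+1, p))%type.
Local Notation I := ('I_n.+1 + 'I_n.+1 * 'I_p)%type.
Local Notation mu := (@lebesgue_outer R n.+1 p).
Local Open Scope ereal_scope.

Lemma lebesgue_outer0 : mu set0 = 0.
Proof.
apply/eqP; rewrite eq_le lebesgue_outer_ge0 andbT.
apply: (le_trans (@lebesgue_outer_cover _ _ _ _ (fun=> (0%R, 0%R)) _)) => //.
rewrite eseries0// => k _ _.
rewrite box_volumeE (bigD1 (inl ord0 : I))//= !mxE subrr max_l// mul0r//.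
Qed.

HB.instance Definition _ := isOuterMeasure.Build R E mu
  lebesgue_outer0 lebesgue_outer_ge0 (@le_lebesgue_outer R n.+1 p)
  (@lebesgue_outer_sigma_subadditive R n.+1 p).

Definition half_space (k : I) (a : R) : set E := [set z | (entry z k <= a)%R].

(** A half space cuts every box into two boxes whose volumes add up. *)
Lemma half_space_caratheodory k a : mu.-caratheodory (half_space k a).
Proof.
apply: le_caratheodory_measurable => X.
apply: le_ereal_inf_tmp => _ [c Xc <-].
pose lo m : E * E := ((c m).1,
  of_entry (fun j => if j == k then Num.min (entry (c m).2 j) a else entry (c m).2 j)).
pose hi m : E * E :=
  (of_entry (fun j => if j == k then Num.max (entry (c m).1 j) a else entry (c m).1 j),
   (c m).2).
have vE m : (box_volume (c m))%:E = (box_volume (lo m))%:E + (box_volume (hi m))%:E.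
  rewrite -EFinD; congr EFin; rewrite !box_volumeE (bigD1 k)//=.
  rewrite [X in _ = (X + _)%R](bigD1 k)//= [X in _ = (_ + X)%R](bigD1 k)//=.
  rewrite !of_entryK eqxx.
  under [X in _ = (_ * X + _)%R]eq_bigr => j /negPf jk do rewrite of_entryK jk.
  under [X in _ = (_ + _ * X)%R]eq_bigr => j /negPf jk do rewrite of_entryK jk.
  rewrite -mulrDl; congr (_ * _)%R.
  move: (entry _ k) (entry _ k) => l u.
  by rewrite !maxEle !minEle; repeat case: ifPn; rewrite -?ltNge; lra.
have v0 (i : E * E) : 0 <= (box_volume i)%:E by rewrite lee_fin box_volume_ge0.
rewrite (eq_eseriesr (fun m _ => vE m)) nneseriesD//.
apply: leeD; apply: lebesgue_outer_cover => z [/Xc [m _]]; rewrite !boxE/=.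
  move=> zm zH; exists m => //; rewrite boxE => j; rewrite /= !of_entryK.
  have /andP[-> zj] := zm j; case: eqP => //= jk; rewrite le_min zj/= jk//.
move=> zm /negP; rewrite -ltNge => zH; exists m => //; rewrite boxE => j; rewrite /= !of_entryK.
have /andP[zj ->] := zm j; case: eqP => [jk|_]; rewrite andbT// gt_max zj/= jk//.
Qed.

Definition half_spaces : set (set E) := [set half_space ka.1 ka.2 | ka in [set: I * R]].

(** The Borel sets: the half spaces orthogonal to the axes generate them. *)
Definition borelE := g_sigma_algebraType half_spaces.

Lemma measurable_caratheodory (A : set borelE) : measurable A -> mu.-caratheodory A.
Proof.
move: A; apply: smallest_sub => [|_ [[k a] _ <-]]; last exact: half_space_caratheodory.
exact: (sigma_algebra_measurable (caratheodory_type mu)).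
Qed.

Definition lebesgueE : set borelE -> \bar R := mu.

Lemma lebesgueE_sigma_additive : semi_sigma_additive lebesgueE.
Proof.
move=> F mF tF mUF; apply: caratheodory_measure_sigma_additive => //.
  by move=> i; exact: measurable_caratheodory.
exact: measurable_caratheodory.
Qed.

HB.instance Definition _ := isMeasure.Build _ borelE R lebesgueE
  lebesgue_outer0 lebesgue_outer_ge0 lebesgueE_sigma_additive.

Lemma measurable_entry k : measurable_fun [set: borelE] (fun z : borelE => entry z k).
Proof.
apply: (measurability _ (RGenOInfty.measurableE R)) => _ [_ [a ->] <-]; rewrite setTI.
rewrite [X in measurable X](_ : _ = ~` half_space k a).
  by apply: measurableC; apply: sub_sigma_algebra; exists (k, a).
apply/seteqP; split => z /=; rewrite in_itv/= andbT /half_space/= ltNge.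
  by move/negP.
by move=> /negP.
Qed.

Lemma measurable_fun_entryP d (T : measurableType d) (f : T -> borelE) :
  (forall k, measurable_fun [set: T] (fun x => entry (f x) k)) ->
  measurable_fun [set: T] f.
Proof.
move=> mf; apply: (@measurability _ _ T borelE setT f half_spaces erefl).
move=> _ [_ [[k a] _ <-] <-]; rewrite setTI.
have := mf k measurableT `]-oo, a]%classic (measurable_itv _); rewrite setTI.
by congr measurable; apply/seteqP; split => z /=; rewrite in_itv.
Qed.

Lemma measurable_cball (z : borelE) (r : R) : (0 <= r)%R ->
  measurable [set w : borelE | (`|w - z| <= r)%R].
Proof.
move=> r0.
rewrite [X in measurable X](_ : _ =
    \bigcap_(k in [set: I]) [set w : borelE | (`|entry w k - entry z k| <= r)%R]); last first.
  apply/seteqP; split => w /=.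
    by move=> /(norm_entryP _ r0) h k _ /=; rewrite -entryB.
  by move=> h; apply/(norm_entryP _ r0) => k; rewrite entryB; exact: h.
apply: fin_bigcap_measurable => // k _.
have mk : measurable_fun setT (fun w : borelE => entry w k - entry z k)%R.
  by apply: measurable_funB => //; exact: measurable_entry.
have := mk measurableT `[(- r)%R, r]%classic (measurable_itv _); rewrite setTI.
by congr measurable; apply/seteqP; split => w /=; rewrite in_itv/= ler_norml.
Qed.

(** An open set is the union of the balls with rational centre and radius
    [1 / (m + 1)] that it contains. *)
Lemma open_measurableE (U : set E) : open U -> measurable (U : set borelE).
Proof.
move=> oU; pose q (f : {ffun I -> rat}) : borelE := of_entry (fun k => ratr (f k)).
pose r (m : nat) : R := (m.+1%:R^-1)%R.
have -> : U = \bigcup_(x in [set x : {ffun I -> rat} * nat |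
    [set w : E | (`|w - q x.1| <= r x.2)%R] `<=` U]) [set w | (`|w - q x.1| <= r x.2)%R].
  apply/seteqP; split => [z Uz|z [x xU]]; last exact: xU.
  have /nbhs_ballP[e /= e0 eU] := open_nbhs_nbhs (conj oU Uz).
  have [m /andP[_ me]] : exists m, (0 < r m)%R && (r m < e / 2)%R.
    have e20 : (0 < e / 2)%R by rewrite divr_gt0.
    have [m _] := near_infty_natSinv_lt (PosNum e20).
    by move=> /(_ m (leqnn _)) /= h; exists m; rewrite h invr_gt0 ltr0n.
  have rm0 : (0 < r m)%R by rewrite invr_gt0 ltr0n.
  have /choice[f fz] : forall k, exists a : rat, (`|entry z k - ratr a| <= r m)%R.
    move=> k; have : (entry z k - r m < entry z k + r m)%R by lra.
    by move=> /rat_in_itvoo[a]; rewrite in_itv/= => /andP[h1 h2]; exists a; rewrite ler_norml; lra.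
  have zq : (`|z - q (finfun f)| <= r m)%R.
    by apply/(norm_entryP _ (ltW rm0)) => k; rewrite entryB of_entryK ffunE.
  exists (finfun f, m) => //= w /= wq; apply: eU; rewrite -ball_normE /=.
  rewrite (le_lt_trans (ler_distD (q (finfun f)) _ _))// (distrC _ w).
  by rewrite (le_lt_trans (lerD zq wq))//; lra.
rewrite bigcup_mkcond; apply: countable_bigcupT_measurable => // x.
by case: ifP => // _; apply: measurable_cball; rewrite /r invr_ge0.
Qed.

Lemma continuous_measurableE (f : E -> R) :
  continuous f -> measurable_fun [set: borelE] (f : borelE -> R).
Proof.
move=> cf; apply: (measurability _ (RGenOpens.measurableE R)) => _ [_ [a [b ->]] <-].
by rewrite setTI; apply: open_measurableE; apply: open_comp => //; exact: interval_open.
Qed.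

Lemma lebesgueE_box (a : R) : lebesgueE [set w | (`|w| <= a)%R] < +oo.
Proof.
pose c (m : nat) : E * E := if m is 0 then (of_entry (fun=> (- a - 1)%R), of_entry (fun=> a))
  else (0, 0)%R.
apply: (@le_lt_trans _ _ (\sum_(0 <= k <oo) (box_volume (c k))%:E)).
  apply: lebesgue_outer_cover => w /= wa; exists 0%N => //; rewrite boxE => k /=.
  rewrite !of_entryK; have := le_trans (entry_norm w k) wa.
  by rewrite ler_norml => /andP[h1 h2]; apply/andP; split => //; lra.
rewrite (nneseries_split 0 1) => [|? _]; last by rewrite lee_fin box_volume_ge0.
rewrite big_nat1 [X in _ + X]eseries0 ?adde0 ?ltry//= => -[//|k] _ _ /=.
by rewrite box_volumeE (bigD1 (inl ord0 : I))//= !mxE subrr max_l// mul0r.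
Qed.

Lemma lebesgueE_sigma_finite : sigma_finite setT lebesgueE.
Proof.
exists (fun m : nat => [set w : borelE | (`|w| <= m%:R)%R]).
  apply/seteqP; split => // z _; exists (Num.bound `|z|) => //=.
  exact/ltW/archi_boundP.
move=> m; split; last exact: lebesgueE_box.
rewrite [X in measurable X](_ : _ = [set w : borelE | (`|w - 0| <= m%:R)%R]).
  exact: measurable_cball.
by apply/seteqP; split => w /=; rewrite subr0.
Qed.

HB.instance Definition _ := @Measure_isSigmaFinite.Build _ borelE R lebesgueE
  lebesgueE_sigma_finite.

(** Translating a cover by boxes gives a cover by boxes of the same volumes. *)
Lemma lebesgue_outer_translate_le (A : set E) (v : E) :
  mu [set x | A (x + v)%R] <= mu A.
Proof.
apply: le_ereal_inf_tmp => _ [c Ac <-].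
pose c' m : E * E := ((c m).1 - v, (c m).2 - v)%R.
rewrite (eq_eseriesr (g := fun m => (box_volume (c' m))%:E)); last first.
  move=> m _; congr EFin; rewrite !box_volumeE; apply: eq_bigr => k _.
  by rewrite !entryB; congr Num.max; ring.
apply: lebesgue_outer_cover => z /Ac[m _]; rewrite boxE => zm; exists m => //.
rewrite boxE => k; have := zm k; rewrite entryD !entryB.
by rewrite ltrBlDr lerBrDr.
Qed.

Lemma lebesgue_outer_translate (A : set E) (v : E) :
  mu [set x | A (x + v)%R] = mu A.
Proof.
apply/eqP; rewrite eq_le lebesgue_outer_translate_le/=.
apply: le_trans (lebesgue_outer_translate_le _ (- v)%R).
by apply: le_lebesgue_outer => x /=; rewrite subrK.
Qed.

(** Fubini along a direction: average the null sections over the starting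
    point and use that every translate of A has the same measure as A. *)
Lemma null_of_null_lines (A : set borelE) (v : E) : measurable A ->
  (forall x : E, (@lebesgue_measure R) [set t | A (x + t *: v)%R] = 0) ->
  mu A = 0.
Proof.
move=> mA A0.
pose phi (z : borelE * R) : borelE := (z.1 + z.2 *: v)%R.
have mphi : measurable_fun setT phi.
  apply: measurable_fun_entryP => k.
  rewrite [X in measurable_fun _ X](_ : _ = fun z : borelE * R =>
    (entry (z.1 : E) k + z.2 * entry v k)%R); last first.
    by apply/funext => z; rewrite /phi entryD entryZ.
  apply: measurable_funD.
    exact: (measurableT_comp (measurable_entry k) measurable_fst).
  by apply: measurable_funM => //.
pose S : set (borelE * R) := (phi @^-1` A) `&` (setT `*` `[0%R, 1%R]).
have mS : measurable S.
  apply: measurableI; first by rewrite -[X in measurable X]setTI; exact: mphi.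
  by apply: measurableX => //.
have := indic_fubini_tonelli lebesgueE (@lebesgue_measure R) mS.
rewrite indic_fubini_tonelli_FE//.
rewrite indic_fubini_tonelli_GE//.
rewrite integral0_eq; last first.
  move=> x _ /=; apply/eqP; rewrite eq_le measure_ge0 andbT -(A0 x).
  apply: le_measure; rewrite ?inE.
  - exact: measurable_xsection.
  - have := measurable_xsection x (mphi measurableT A mA); rewrite setTI.
    by congr measurable; apply/seteqP; split => t; rewrite /xsection/= ?inE.
  - by move=> t; rewrite /xsection/= inE => -[].
move=> /esym.
have sectE (t : R) : t \in `[0%R, 1%R] -> lebesgueE (ysection S t) = mu A.
  move=> t01; rewrite -(lebesgue_outer_translate A (t *: v)%R); congr mu.
  by apply/seteqP; split=> x; rewrite /ysection/= inE; [case|split].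
have -> : lebesgueE \o ysection S = (fun t : R => mu A * (\1_`[0%R, 1%R] t)%:E).
  apply/funext => t /=; rewrite indicE; have [t01|t01] := boolP (t \in `[0%R, 1%R]).
    by rewrite mem_set// mule1 sectE.
  rewrite memNset ?mule0; last by move/negP : t01.
  rewrite (_ : ysection S t = set0) ?measure0//.
  by apply/seteqP; split => x//; rewrite /ysection/= inE => -[_ [_]] /=; rewrite (negPf t01).
rewrite ge0_integralZl//; last 2 first.
- by apply/measurable_EFinP; exact: measurable_indic.
- exact: lebesgue_outer_ge0.
have l1 : (@lebesgue_measure R) `[0%R, 1%R]%classic = 1.
  by rewrite lebesgue_measure_itv/= lte_fin ltr01 oppr0 adde0.
rewrite integral_indic// setIT [X in mu A * X](_ : _ = 1); last exact: l1.
by rewrite mule1.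
Qed.

End LebesgueMeasure.

(** * Lipschitz functions of one real variable *)

Section LipschitzDerivable.
Context {R : realType}.
Variables (F : R -> R) (K : R).
Hypothesis K0 : 0 < K.
Hypothesis ndF : {homo F : x y / x <= y}.
Hypothesis lipF : forall x y, x <= y -> F y - F x <= K * (y - x).

Let contF : continuous F.
Proof.
move=> x; apply/cvgrPdist_le => e e0; near=> y.
have : `|F x - F y| <= K * `|x - y|.
  have [xy|/ltW yx] := leP x y.
    by rewrite distrC ger0_norm ?subr_ge0 ?ndF// distrC ger0_norm ?subr_ge0 ?lipF.
  by rewrite ger0_norm ?subr_ge0 ?ndF// ger0_norm ?subr_ge0 ?lipF.
move/le_trans; apply; rewrite mulrC -ler_pdivlMr//; near: y.
by apply: cvgr_dist_le => //; rewrite divr_gt0.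
Unshelve. all: by end_near. Qed.

HB.instance Definition _ := isCumulative.Build R _ R F ndF (right_continuousW contF).

Local Notation nuF := (lebesgue_stieltjes_measure F).
Local Notation lam := (@lebesgue_measure R).

Let nuF_dominated A : lam A = 0%E -> nuF A = 0%E.
Proof.
move=> A0; apply/eqP; rewrite eq_le measure_ge0 andbT.
apply/lee_addgt0Pr => e e0; rewrite add0e.
have eK : 0 < e / K by rewrite divr_gt0.
have : lam A \is a fin_num by rewrite A0.
move=> /(lb_ereal_inf_adherent eK)[_ [B [mB AB] <-]].
rewrite [X in (X + _)%E](_ : _ = 0%E) ?add0e; last exact: A0.
move=> Be; apply: (@le_trans _ _ (\sum_(k <oo) wlength F (B k))%E).
  by apply: ereal_inf_lbound; exists B.
apply: (@le_trans _ _ (\sum_(k <oo) (K%:E * wlength idfun (B k)))%E).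
  apply: lee_nneseries => [k _ _|k _]; first exact: wlength_ge0.
  have [->|[[a b] /= ab ->]] := (ocitvP _).1 (mB k).
    by rewrite !wlength0 mule0.
  by rewrite !wlength_itv_bnd ?(ltW ab)// -EFinM lee_fin lipF// ltW.
rewrite nneseriesZl; last by move=> k _; exact: wlength_ge0.
have K0E : (0 <= K%:E)%E by rewrite lee_fin ltW.
apply: (le_trans (lee_wpmul2l K0E (ltW Be))).
by rewrite -EFinM mulrCA mulfV ?mulr1 ?gt_eqF.
Qed.

(** The Stieltjes measure of [F] has a density by [nuF_dominated], so [F] is an
    indefinite integral and is differentiable at the Lebesgue points of the
    density.  Working on a bounded interval makes the measure finite. *)
Lemma nondecreasing_lipschitz_ae_derivable_bounded (M : R) :
  lam.-negligible [set x | -M < x < M /\ ~ derivable F x 1].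
Proof.
have [M0|M0] := leP M 0.
  apply: (negligibleS _ (negligible_set0 lam)).
  by move=> x [/andP[h1 h2] _]; have := lt_trans h1 h2; lra.
have mD : measurable (`]-M, M]%classic : set (measurableTypeR R)) by exact: measurable_itv.
have nuD a b : a <= b -> nuF `]a, b]%classic = (F b - F a)%:E.
  move=> ab; rewrite [LHS]measurable_mu_extE/= ?wlength_itv_bnd//.
  exact: is_ocitv.
have Doo : (nuF `](- M)%R, M]%classic < +oo)%E by rewrite nuD ?ltry//; lra.
pose nu : {finite_measure set (measurableTypeR R) -> \bar R} := mfrestr mD Doo.
have nulam : nu `<< lam.
  apply/null_content_dominatesP => A mA A0.
  apply/eqP; rewrite eq_le measure_ge0 andbT -(nuF_dominated A0).
  by apply: le_measure; rewrite ?inE//; exact: measurableI.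
have [h [_ hfin hint hE]] := radon_nikodym_sigma_finite nulam.
pose f : R -> R := fine \o h.
have fh : EFin \o f = h by apply/funext => x /=; rewrite fineK.
have intf : lam.-integrable setT (EFin \o f) by rewrite fh.
have locf : locally_integrable setT f.
  have := integrable_locally measurableT intf.
  by rewrite patch_setT.
have := lebesgue_differentiation locf; apply: negligibleS => x [/andP[x1 x2]] + fx.
apply.
have intfM : lam.-integrable [set` Interval (BRight (-M)) (BRight M)] (EFin \o f).
  by apply: integrableS intf.
have [/= + _] := FTC1_lebesgue_pt x2 intfM x1 fx.
set G := (fun _ => _) => dG.
have FE : {near x, G =1 (fun y => F y - F (- M))}.
  near=> y; have yM : - M < y < M.
    by apply/andP; split; near: y; [exact: lt_nbhsr|exact: lt_nbhsl].
  have /andP[My yM'] := yM.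
  have -> : G y = fine (\int[lam]_(t in `](- M)%R, y]) h t)%E by rewrite /G /Rintegral -fh.
  rewrite -hE; last exact: measurable_itv.
  rewrite /nu /= /mfrestr /mrestr setIidl; last first.
    by move=> t /=; rewrite !in_itv/= => /andP[-> /le_trans]; apply; exact: ltW.
  by rewrite nuD// ltW.
have dF : derivable (fun y => F y - F (- M)) x 1.
  exact: near_eq_derivable dG.
have -> : F = (fun y => F y - F (- M)) + cst (F (- M)).
  by apply/funext => y; rewrite fctE /= subrK.
by apply: derivableD => //; exact: derivable_cst.
Unshelve. all: by end_near. Qed.

Lemma nondecreasing_lipschitz_ae_derivable :
  lam.-negligible [set x | ~ derivable F x 1].
Proof.
have := negligible_bigcup (fun m : nat => nondecreasing_lipschitz_ae_derivable_bounded m%:R).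
apply: negligibleS => x dx; exists (Num.bound `|x|).+1 => //=; split => //.
rewrite -ltr_norml; apply: (lt_le_trans (archi_boundP (normr_ge0 x))).
by rewrite ler_nat.
Qed.

End LipschitzDerivable.

(** Adding a large multiple of the identity makes the function nondecreasing. *)
Lemma lipschitz_ae_derivable {R : realType} (f : R -> R) (K : R) :
  (forall x y, `|f x - f y| <= K * `|x - y|) ->
  (@lebesgue_measure R).-negligible [set x | ~ derivable f x 1].
Proof.
move=> lipf; pose F x := f x + (`|K| + 1) * x.
have lf x y : x <= y -> `|f y - f x| <= (`|K| + 1) * (y - x).
  move=> xy; have yx0 : 0 <= y - x by rewrite subr_ge0.
  apply: (le_trans (lipf y x)); rewrite (ger0_norm yx0) ler_wpM2r//.
  by rewrite (le_trans (ler_norm K))// lerDl.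
have K0 : 0 < 2 * (`|K| + 1) by rewrite mulr_gt0// ltr_wpDl.
have ndF : {homo F : x y / x <= y}.
  by move=> x y /lf; rewrite ler_norml /F => /andP[+ _]; lra.
have lipF x y : x <= y -> F y - F x <= 2 * (`|K| + 1) * (y - x).
  by move=> /lf; rewrite ler_norml /F => /andP[_]; lra.
have := nondecreasing_lipschitz_ae_derivable K0 ndF lipF.
apply: negligibleS => x; apply: contra_not => dF.
have -> : f = F - (fun y => (`|K| + 1) * y).
  by apply/funext => y; rewrite /F !fctE addrK.
by apply: derivableB => //; apply: derivableM => //; exact: derivable_id.
Qed.

(** A point of density cannot sit next to holes whose size is a fixed
    proportion of their distance. *)
Lemma porous_negligible {R : realType} (C P : set R) (eta : R) :
  0 < eta -> eta < 1 -> measurable C -> P `<=` C ->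
  (forall x, P x -> forall d, 0 < d -> exists2 t, 0 < `|t| < d &
     forall s, `|s - t| <= eta * `|t| -> ~ C (x + s)) ->
  (@lebesgue_measure R).-negligible P.
Proof.
move=> eta0 eta1 mC PC porous.
have := lebesgue_density mC; apply: negligibleS => x Px /=.
rewrite indicE mem_set; last exact: PC.
have c1 : ((1 - eta / 2)%:E < 1%:E :> \bar R)%E by rewrite lte_fin; lra.
move=> /(_ _ (open_ereal_gt' c1)) /nbhs_ballP[d /= d0 dr].
have d20 : 0 < d / 2 by rewrite divr_gt0.
have [t /andP[t0 td] hole] := porous _ Px _ d20.
have r0 : 0 < 2 * `|t| by rewrite mulr_gt0.
have r2d : ball (0 : R) d (2 * `|t|).
  by rewrite /ball/= sub0r normrN gtr0_norm//; lra.
have := dr _ r2d r0; rewrite lebesgue_measure_ball ?ltW// inver gt_eqF ?mulrn_wgt0//.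
have mB y r : measurable (ball y r : set R) by exact: measurable_ball.
pose H : set R := ball (x + t) (eta * `|t|).
have HE : lebesgue_measure H = (eta * `|t| *+ 2)%:E.
  by rewrite lebesgue_measure_ball// ltW// mulr_gt0.
have mCB : measurable (C `&` ball x (2 * `|t|)) by exact: measurableI.
have disj : (C `&` ball x (2 * `|t|)) `&` H = set0.
  apply/seteqP; split => // y [[Cy _]]; rewrite /H /ball/= => yt.
  apply: (hole (y - x)); last by rewrite addrC subrK.
  by rewrite distrC (_ : t - (y - x) = x + t - y) ?ltW//; ring.
have sub : (C `&` ball x (2 * `|t|)) `|` H `<=` ball x (2 * `|t|).
  move=> y [[]//|]; rewrite /H /ball/= => yt.
  have -> : x - y = (x + t - y) + - t by ring.
  rewrite (le_lt_trans (ler_normD _ _))// normrN mulr_natl mulr2n ltrD2r.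
  by apply: (lt_trans yt); rewrite gtr_pMl.
have : (lebesgue_measure (C `&` ball x (2 * `|t|)) + lebesgue_measure H <=
    (2 * `|t| *+ 2)%:E)%E.
  rewrite -(lebesgue_measure_ball x (ltW r0)) -measureU//.
    apply: le_measure => //; rewrite ?inE; last exact: mB.
    by apply: measurableU => //; exact: mB.
  exact: mB.
rewrite HE; case: (lebesgue_measure _) => [m| |]//.
  have double (a : R) : a *+ 2 = 2 * a by rewrite mulr_natl.
  rewrite -EFinD -EFinM lee_fin lte_fin (double (2 * _)) (double (eta * _)) => h1.
  rewrite ltr_pdivlMr ?mulr_gt0// => h2; lra.
by rewrite mulNyr gtr0_sg ?mul1e// invr_gt0 mulrn_wgt0.
Qed.

(** * Directional derivatives of a Lipschitz function *)

Lemma near_rat {R : realType} (x : R) (P : R -> Prop) :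
  (\forall y \near x, P y) -> exists q : rat, P (ratr q).
Proof.
move=> /nbhs_ballP[e /= e0 eP].
have : x - e < x + e by lra.
move=> /rat_in_itvoo[q]; rewrite in_itv/= => /andP[h1 h2]; exists q; apply: eP.
by rewrite /ball/= ltr_norml; lra.
Qed.

Lemma natSinv_lt {R : realType} (e : R) : 0 < e -> exists m, (m.+1%:R^-1 : R) < e.
Proof.
by move=> e0; have [m _ /(_ m (leqnn _))] := near_infty_natSinv_lt (PosNum e0); exists m.
Qed.

Section Lipschitz.
Context {R : realType} {n p : nat}.
Local Notation E := ('cV[R]_n.+1 * 'M[R]_(n.+1, p))%type.
Local Notation I := ('I_n.+1 + 'I_n.+1 * 'I_p)%type.
Local Notation borel := (@borelE R n p).
Local Notation mu := (@lebesgue_outer R n.+1 p).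
Variables (f : E -> R) (K : R).
Hypothesis K0 : 0 < K.
Hypothesis lipf : forall z w, `|f z - f w| <= K * `|z - w|.

Lemma lipschitz_contE : continuous f.
Proof.
move=> x; apply/cvgrPdist_le => e e0; near=> y.
apply: (le_trans (lipf _ _)); rewrite mulrC -ler_pdivlMr//; near: y.
by apply: cvgr_dist_le => //; rewrite divr_gt0.
Unshelve. all: by end_near. Qed.

Definition slope (v z : E) (h : R) : R := h^-1 * (f (z + h *: v) - f z).

Lemma derivable_slopeP v z l :
  derivable f z v /\ 'D_v f z = l <-> slope v z h @[h --> 0^'] --> l.
Proof.
have -> : slope v z = fun h => h^-1 *: ((f \o shift z) (h *: v) - f z).
  by apply/funext => h; rewrite /slope /= (addrC z).
split => [[dv <-]|h]; first exact: dv.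
by split; [apply/cvg_ex; exists l|apply/cvg_lim].
Qed.

Lemma slope_cont v h : continuous (slope v ^~ h).
Proof.
move=> z; apply: cvgM; first exact: cvg_cst.
apply: cvgB; last exact: lipschitz_contE.
apply: (@cvg_comp _ _ _ (fun z : E => z + h *: v) f _ (nbhs (z + h *: v))).
  by apply: cvgD; [exact: cvg_id|exact: cvg_cst].
exact: lipschitz_contE.
Qed.

Lemma slope_cont_step v z h : h != 0 -> {for h, continuous (slope v z)}.
Proof.
move=> h0; apply: cvgM; first by apply: cvgV => //; exact: cvg_id.
apply: cvgB; last exact: cvg_cst.
apply: (@cvg_comp _ _ _ (fun h => z + h *: v) f _ (nbhs (z + h *: v))).
  by apply: cvgD; [exact: cvg_cst|apply: cvgZr_tmp; exact: cvg_id].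
exact: lipschitz_contE.
Qed.

(** The Cauchy condition at 0 for the difference quotients, with countably
    many quantifiers so that it defines a Borel set. *)
Definition slope_cauchy v : set borel :=
  \bigcap_(m in [set: nat]) \bigcup_(k in [set: nat])
    \bigcap_(h in [set h : rat * rat | 0 < `|ratr h.1 : R| < k.+1%:R^-1 /\
                                       0 < `|ratr h.2 : R| < k.+1%:R^-1])
    [set z | `|slope v z (ratr h.1) - slope v z (ratr h.2)| <= m.+1%:R^-1].

Lemma measurable_slope_cauchy v : measurable (slope_cauchy v).
Proof.
apply: bigcapT_measurable => m; apply: bigcupT_measurable => k.
rewrite -[X in measurable X]setCK; apply: measurableC; rewrite setC_bigcap bigcup_mkcond.
apply: countable_bigcupT_measurable => // h; case: ifP => // _; apply: measurableC.
have mg : measurable_fun setT (fun z : borel => `|slope v z (ratr h.1) - slope v z (ratr h.2)|).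
  apply: continuous_measurableE => z; apply: cvg_norm.
  by apply: cvgB; exact: slope_cont.
have := mg measurableT `]-oo, m.+1%:R^-1]%classic (measurable_itv _); rewrite setTI.
by congr measurable; apply/seteqP; split => w /=; rewrite in_itv.
Qed.

Lemma slope_cauchyP v z : slope_cauchy v z <-> derivable f z v.
Proof.
split => [cz|dv m _]; last first.
  have /derivable_slopeP h := conj dv (erefl ('D_v f z)).
  have e0 : 0 < (m.+1%:R^-1 / 2 : R) by rewrite divr_gt0.
  move/cvgrPdist_le : h => /(_ _ e0) /nbhs_ballP[d /= d0 dP].
  have [k kd] := natSinv_lt d0.
  exists k => // -[a b] /= [/andP[a0 ak] /andP[b0 bk]].
  have := dP (ratr a); have := dP (ratr b).
  rewrite /ball/= !sub0r !normrN -!normr_gt0 => /(_ (lt_trans bk kd) b0) h1.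
  move=> /(_ (lt_trans ak kd) a0) h2.
  rewrite (_ : _ - _ = ('D_v f z - slope v z (ratr b)) - ('D_v f z - slope v z (ratr a))); last by ring.
  by rewrite (le_trans (ler_normB _ _))// (le_trans (lerD h1 h2))// -splitr.
suff : cvg (slope v z h @[h --> 0^']) by move=> /cvg_ex[l /derivable_slopeP[]].
apply: cauchy_cvg; apply: cauchy_exP => e e0.
have [m me] := natSinv_lt e0; have [k _ kP] := cz m Logic.I.
have k0 : 0 < (k.+1%:R^-1 : R) by rewrite invr_gt0.
have [a] : exists a : rat, 0 < `|ratr a : R| < k.+1%:R^-1.
  have := rat_in_itvoo k0 => -[a]; rewrite in_itv/= => /andP[h1 h2].
  by exists a; rewrite gtr0_norm// h1.
move=> ak; exists (slope v z (ratr a)).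
suff : \forall h \near 0^', `|slope v z (ratr a) - slope v z h| < e by [].
near=> h.
have h0 : h != 0 by near: h; exact: nbhs_dnbhs_neq.
have hk : `|h| < k.+1%:R^-1.
  near: h; apply: dnbhs0_lt; exact: k0.
apply: (le_lt_trans _ me); apply/ler_addgt0Pr => d d0.
have [b [b0 bk bd]] : exists b : rat, [/\ 0 < `|ratr b : R|, `|ratr b : R| < k.+1%:R^-1 &
     `|slope v z h - slope v z (ratr b)| <= d].
  apply: (@near_rat _ h (fun b => [/\ 0 < `|b|, `|b| < k.+1%:R^-1 & `|slope v z h - slope v z b| <= d])).
  have cn : `|b| @[b --> h] --> `|h| by apply: cvg_norm; exact: cvg_id.
  near=> b; split; near: b.
  - by apply: (cvgr_gt `|h|) => //; rewrite normr_gt0.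
  - by apply: (cvgr_lt `|h|).
  - by apply: cvgr_dist_le d0; exact: slope_cont_step.
have := kP (a, b); rewrite /= b0 bk => /(_ (conj ak isT)) h1.
rewrite (le_trans (ler_distD (slope v z (ratr b)) _ _))//.
by rewrite lerD// distrC.
Unshelve. all: by end_near. Qed.

Lemma negligible_lebesgue0 (A : set (measurableTypeR R)) : measurable A ->
  (@lebesgue_measure R).-negligible A -> (@lebesgue_measure R) A = 0%E.
Proof. by move=> mA /negligibleP-/(_ mA). Qed.

Lemma measurable_line (A : set borel) (x v : E) : measurable A ->
  measurable [set t : R | A (x + t *: v)].
Proof.
move=> mA.
have : measurable_fun setT (fun t : R => x + t *: v : borel).
  apply: measurable_fun_entryP => k.
  under eq_fun do rewrite entryD entryZ.
  by apply: measurable_funD => //; apply: measurable_funM.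
by move=> /(_ measurableT _ mA); rewrite setTI.
Qed.

Lemma ae_directional_derivative v : mu [set z | ~ derivable f z v] = 0%E.
Proof.
have -> : [set z | ~ derivable f z v] = ~` slope_cauchy v.
  by apply/seteqP; split => z /=; apply: contra_not => /slope_cauchyP.
apply: (null_of_null_lines (v := v)).
  by apply: measurableC; exact: measurable_slope_cauchy.
move=> x; apply: negligible_lebesgue0.
  by apply: measurable_line; apply: measurableC; exact: measurable_slope_cauchy.
have lipg a b : `|f (x + a *: v) - f (x + b *: v)| <= (K * `|v|) * `|a - b|.
  rewrite (le_trans (lipf _ _))// -mulrA ler_wpM2l ?(ltW K0)//.
  by rewrite opprD addrACA subrr add0r -scalerBl normrZ mulrC.
have := lipschitz_ae_derivable lipg; apply: negligibleS => t /=.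
apply: contra_not => /cvg_ex[l dg]; apply/slope_cauchyP.
suff /derivable_slopeP[] : slope v (x + t *: v) h @[h --> 0^'] --> l by [].
apply: cvg_trans dg; apply: near_eq_cvg; apply: nearW => h /=.
rewrite /slope /= -addrA -scalerDl; congr (_ * (f (_ + _ *: _) - _)).
by rewrite [h *: 1]mulr1 [h + t]addrC.
Qed.

Definition near_slope v (b e d : R) : set borel :=
  [set z | forall t : R, `|t| < d -> `|f (z + t *: v) - f z - t * b| <= e * `|t|].

(** Rational steps [t] make this set Borel.  The constant 3 leaves room for two
    errors of size [e]: that of the slope at a neighbouring point, and that of
    moving to this point. *)
Definition slope_breaks (u v : E) (b e : R) : set borel :=
  \bigcap_(k in [set: nat]) \bigcup_(t in [set t : rat | 0 < `|ratr t : R| < k.+1%:R^-1])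
    [set z | 3 * e * `|ratr t| < `|f (z + ratr t *: u + ratr t *: v) - f (z + ratr t *: u) - ratr t * b|].

Lemma cont_shift (a : E) : continuous (fun z : E => f (z + a)).
Proof.
move=> z; apply: (@cvg_comp _ _ _ (fun z : E => z + a) f _ (nbhs (z + a))).
  by apply: cvgD; [exact: cvg_id|exact: cvg_cst].
exact: lipschitz_contE.
Qed.

Lemma measurable_near_slope v b e d : measurable (near_slope v b e d).
Proof.
rewrite -[X in measurable X]setCK; apply: measurableC; apply: open_measurableE.
rewrite openC.
rewrite [X in closed X](_ : _ = \bigcap_(t in [set t : R | `|t| < d])
   (fun z : E => `|f (z + t *: v) - f z - t * b|) @^-1` [set x | x <= e * `|t|]); last first.
  by apply/seteqP; split.
apply: closed_bigI => t _; apply: closed_comp; last exact: closed_le.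
move=> z _; apply: cvg_norm; apply: cvgB; last exact: cvg_cst.
by apply: cvgB; [exact: cont_shift|exact: lipschitz_contE].
Qed.

Lemma measurable_slope_breaks u v b e : measurable (slope_breaks u v b e).
Proof.
apply: bigcapT_measurable => k; rewrite bigcup_mkcond; apply: bigcupT_measurable_rat => t.
case: ifP => // _; apply: open_measurableE.
apply: (@open_comp _ _ (fun z : E => `|f (z + ratr t *: u + ratr t *: v) - f (z + ratr t *: u) - ratr t * b|)
  [set x | 3 * e * `|ratr t| < x]); last exact: open_gt.
move=> z _; apply: cvg_norm; apply: cvgB; last exact: cvg_cst.
apply: cvgB; last exact: cont_shift.
under eq_fun do rewrite -addrA; rewrite -addrA; exact: cont_shift.
Qed.

(** If the slope along [v] breaks at [z + t u] then, [f] being Lipschitz, it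
    breaks at [z + s u] whenever [s - t] is small relative to [t].  So on each
    line parallel to [u] the points of near slope [b] have holes next to [z] of
    size proportional to [t]. *)
Lemma near_slope_breaks_null u v b e d : 0 < e -> 0 < d ->
  mu (near_slope v b e d `&` slope_breaks u v b e) = 0%E.
Proof.
move=> e0 d0.
have mC := measurable_near_slope v b e d.
have mP : measurable (near_slope v b e d `&` slope_breaks u v b e).
  by apply: measurableI => //; exact: measurable_slope_breaks.
apply: (null_of_null_lines (v := u)) => // x.
apply: negligible_lebesgue0; first exact: measurable_line.
pose eta := Num.min (1 / 2) (e / (2 * K * (`|u| + 1))).
have u1 : 0 < `|u| + 1 by rewrite ltr_wpDl.
have eta0 : 0 < eta by rewrite lt_min !divr_gt0// !mulr_gt0.
have eta1 : eta < 1 by rewrite gt_min; apply/orP; left; lra.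
have etae : 2 * K * `|u| * eta <= e.
  have : eta <= e / (2 * K * (`|u| + 1)) by rewrite ge_min lexx orbT.
  rewrite ler_pdivlMr ?mulr_gt0// => h; apply: le_trans h.
  rewrite [leRHS]mulrC ler_wpM2r ?(ltW eta0)// ler_wpM2l ?mulr_ge0 ?(ltW K0)//.
  by rewrite lerDl.
apply: (@porous_negligible _ [set t | near_slope v b e d (x + t *: u)] _ eta) => //.
- exact: measurable_line.
- by move=> t [].
move=> a [_ Pa] d1 d10.
have dm0 : 0 < Num.min d d1 by rewrite lt_min d0 d10.
have [k kd] := natSinv_lt dm0.
have [t /andP[t0 tk] big] := Pa k Logic.I.
have td : `|ratr t| < d by apply: (lt_le_trans (lt_trans tk kd)); rewrite ge_min lexx.
exists (ratr t) => [|s st Cs].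
  by rewrite t0 (lt_le_trans (lt_trans tk kd))// ge_min lexx orbT.
have := Cs _ td; move: big t0; set T := ratr t => big t0.
rewrite scalerDl addrA => h.
have st1 w : `|f (x + a *: u + T *: u + w) - f (x + a *: u + s *: u + w)| <= K * (eta * `|T| * `|u|).
  apply: (le_trans (lipf _ _)); rewrite ler_wpM2l ?(ltW K0)//.
  rewrite (_ : _ - _ = (T - s) *: u); last by rewrite scalerBl; apply: entryP => c; rewrite !(entryB,entryD); ring.
  by rewrite normrZ ler_wpM2r// distrC.
have h1 := st1 (T *: v); have := st1 0; rewrite !addr0 => h2.
move: big; apply/negP; rewrite -leNgt.
set A1 := f (_ + _ + T *: v) in h1 *; set A2 := f (x + a *: u + T *: u) in h2 *.
set B1 := f (_ + _ + T *: v) in h1 h *; set B2 := f (x + a *: u + s *: u) in h2 h *.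
have -> : A1 - A2 - T * b = (B1 - B2 - T * b) + (A1 - B1) - (A2 - B2) by ring.
rewrite (le_trans (ler_normB _ _))// (le_trans (lerD (ler_normD _ _) (lexx _)))//.
rewrite (le_trans (lerD (lerD h h1) h2))//.
have : 2 * K * `|u| * eta * `|T| <= e * `|T| by rewrite ler_wpM2r.
have := mulr_ge0 (ltW e0) (normr_ge0 T); lra.
Qed.

Lemma outer_null_bigcup (T : choiceType) (A : T -> set E) : countable [set: T] ->
  (forall i, mu (A i) = 0%E) -> mu (\bigcup_i A i) = 0%E.
Proof.
move=> cT A0; apply/eqP; rewrite eq_le lebesgue_outer_ge0 andbT.
have /countable_injP[g ginj] := cT.
pose B m : set E := \bigcup_(i in [set i | g i = m]) A i.
have -> : \bigcup_i A i = \bigcup_m B m.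
  apply/seteqP; split => z [i _]; first by move=> Az; exists (g i) => //; exists i.
  by move=> [j _ Az]; exists j.
apply: (le_trans (lebesgue_outer_sigma_subadditive B)).
rewrite eseries0// => m _ _.
have [[i gi]|h] := pselect (exists i, g i = m); last first.
  rewrite (_ : B m = set0) ?lebesgue_outer0//.
  by apply/seteqP; split => // z [i gi]; exfalso; apply: h; exists i.
apply/eqP; rewrite eq_le lebesgue_outer_ge0 andbT -(A0 i).
apply: le_lebesgue_outer => z [j gj]; suff -> : j = i by [].
by apply: ginj; rewrite ?inE//= gj gi.
Qed.

Lemma outer_nullU (B C : set E) : mu B = 0%E -> mu C = 0%E -> mu (B `|` C) = 0%E.
Proof.
move=> B0 C0; apply/eqP; rewrite eq_le lebesgue_outer_ge0 andbT.
have : (mu (B `|` C) <= mu B + mu C)%E := outer_measureU2 mu B C.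
by rewrite B0 C0 adde0.
Qed.

(** Where additivity fails, [f] has nearly a rational slope [b] along [v], but
    the quotients along [u + v] and [u] give another slope along [v] from the
    point [z + t u]. *)
Lemma ae_directional_additive u v : mu [set z | [/\ derivable f z u, derivable f z v,
  derivable f z (u + v) & 'D_(u + v) f z <> 'D_u f z + 'D_v f z]] = 0%E.
Proof.
pose A (x : rat * nat * nat) := near_slope v (ratr x.1.1) x.1.2.+1%:R^-1 x.2.+1%:R^-1 `&`
  slope_breaks u v (ratr x.1.1) x.1.2.+1%:R^-1.
apply/eqP; rewrite eq_le lebesgue_outer_ge0 andbT.
have <- : mu (\bigcup_x A x) = 0%E.
  apply: outer_null_bigcup => [|x]; first exact: countableP.
  by apply: near_slope_breaks_null; rewrite invr_gt0.
apply: le_lebesgue_outer => z [].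
move=> hal; have /derivable_slopeP := conj hal (erefl ('D_u f z)); set al := 'D_u f z => du.
move=> hbe; have /derivable_slopeP := conj hbe (erefl ('D_v f z)); set be := 'D_v f z => dv.
move=> hga; have /derivable_slopeP := conj hga (erefl ('D_(u + v) f z)); set ga := 'D_(u + v) f z => duv neq.
have {}neq : 0 < `|ga - al - be|.
  by rewrite normr_gt0; apply/eqP => h; apply: neq; rewrite -[ga]subr0 -h; ring.
have [m mlt] : exists m, m.+1%:R^-1 < `|ga - al - be| / 8 by apply: natSinv_lt; rewrite divr_gt0.
set e := m.+1%:R^-1 in mlt; have e0 : 0 < e by rewrite invr_gt0.
have [b bbe] : exists b : rat, `|be - ratr b| <= e / 2.
  apply: (@near_rat _ be (fun b => `|be - b| <= e / 2)).
  have e20 : 0 < e / 2 by rewrite divr_gt0.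
  by have /cvgrPdist_le/(_ _ e20) := @cvg_id _ (nbhs be).
move/cvgrPdist_le : dv => /(_ (e / 2)) [|d /= d0 dP]; first exact: divr_gt0.
have [k kd] := natSinv_lt d0.
exists (b, m, k) => //; split.
  move=> t /= tk; have [->|t0] := eqVneq t 0.
    by rewrite scale0r addr0 subrr mul0r subrr normr0 mulr0.
  have := dP t; rewrite /ball/= sub0r normrN => /(_ (lt_trans tk kd) t0) h.
  have -> : f (z + t *: v) - f z - t * ratr b =
      t * (be - ratr b - (be - slope v z t)) by rewrite /slope; field.
  rewrite normrM mulrC ler_wpM2r// (le_trans (ler_normB _ _))//.
  by rewrite (le_trans (lerD bbe h))// -splitr.
have cuv : slope (u + v) z h - slope u z h @[h --> 0^'] --> ga - al.
  exact: (cvgB duv du).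
move/cvgrPdist_le : cuv => /(_ e e0) [d' /= d'0 d'P].
move=> k' _; have k'0 : 0 < k'.+1%:R^-1 :> R by rewrite invr_gt0.
have /rat_in_itvoo[t] : 0 < Num.min d' (k'.+1%:R^-1) by rewrite lt_min d'0.
rewrite in_itv/= lt_min => /and3P[t0 td' tk'].
exists t => /=; rewrite gtr0_norm ?t0//.
have := d'P (ratr t); rewrite /ball/= sub0r normrN gtr0_norm// => /(_ td').
rewrite gt_eqF// => /(_ isT); set T : R := ratr t in t0 *.
have -> : f (z + T *: u + T *: v) - f (z + T *: u) - T * ratr b =
    T * ((slope (u + v) z T - slope u z T) - ratr b).
  by rewrite /slope scalerDr addrA; field; rewrite gt_eqF.
rewrite normrM gtr0_norm// mulrC ltr_pM2l//.
set s := (slope _ _ _ - _) => h.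
have : `|ga - al - be| <= `|ga - al - s| + `|s - ratr b| + `|be - ratr b|.
  have -> : ga - al - be = (ga - al - s) + (s - ratr b) - (be - ratr b) by ring.
  by rewrite (le_trans (ler_normB _ _))// lerD2r ler_normD.
rewrite -/e; lra.
Qed.

Lemma slope_scale v z a h : a != 0 -> slope (a *: v) z h = a * slope v z (a * h).
Proof.
move=> a0; rewrite /slope scalerA [h * a]mulrC; have [->|h0] := eqVneq h 0.
  by rewrite mulr0 scale0r addr0 subrr !mulr0.
by field; rewrite ?a0 ?h0.
Qed.

Lemma directionalZ v z a : derivable f z v ->
  derivable f z (a *: v) /\ 'D_(a *: v) f z = a * 'D_v f z.
Proof.
move=> dv; apply/derivable_slopeP; have [->|a0] := eqVneq a 0.
  rewrite scale0r mul0r (_ : slope 0 z = cst 0); first exact: cvg_cst.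
  by apply/funext => h; rewrite /slope scaler0 addr0 subrr mulr0.
rewrite (_ : slope (a *: v) z = fun h => a * slope v z (a * h)); last first.
  by apply/funext => h; exact: slope_scale.
apply: cvgM; first exact: cvg_cst.
have /derivable_slopeP/cvgrPdist_le h := conj dv (erefl ('D_v f z)).
apply/cvgrPdist_le => e e0; have [d /= d0 dP] := h e e0.
exists (d / `|a|) => /=; first by rewrite divr_gt0// normr_gt0.
move=> t; rewrite /ball/= sub0r normrN => td t0; apply: dP.
  by rewrite /ball/= sub0r normrN normrM mulrC -ltr_pdivlMr// normr_gt0.
by rewrite mulf_neq0.
Qed.

Definition unit_vec (k : I) : E := of_entry (fun j => (j == k)%:R).
Definition rat_vec (q : {ffun I -> rat}) : E := of_entry (fun k => ratr (q k)).

Lemma sum_unit_vec (v : E) : v = \sum_k entry v k *: unit_vec k.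
Proof.
apply: entryP => j; pose c := fun z : E => entry z j.
have -> : entry (\sum_k entry v k *: unit_vec k) j = \sum_k entry (entry v k *: unit_vec k) j.
  by apply: (big_morph c) => [a b|]; rewrite /c ?entryD ?entry0.
rewrite (bigD1 j)//= big1 ?addr0 => [|k kj]; rewrite entryZ of_entryK.
  by rewrite eqxx mulr1.
by rewrite eq_sym (negPf kj) mulr0.
Qed.

Definition rational_linear z := forall q r : {ffun I -> rat},
  derivable f z (rat_vec q) /\
  'D_(rat_vec q + rat_vec r) f z = 'D_(rat_vec q) f z + 'D_(rat_vec r) f z.

Lemma ae_rational_linear : mu [set z | ~ rational_linear z] = 0%E.
Proof.
pose A (x : {ffun I -> rat} * {ffun I -> rat}) := [set z | ~ derivable f z (rat_vec x.1)] `|`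
   [set z | ~ derivable f z (rat_vec x.2)] `|` [set z | ~ derivable f z (rat_vec x.1 + rat_vec x.2)] `|`
   [set z | [/\ derivable f z (rat_vec x.1), derivable f z (rat_vec x.2),
    derivable f z (rat_vec x.1 + rat_vec x.2) &
    'D_(rat_vec x.1 + rat_vec x.2) f z <> 'D_(rat_vec x.1) f z + 'D_(rat_vec x.2) f z]].
apply/eqP; rewrite eq_le lebesgue_outer_ge0 andbT.
have <- : mu (\bigcup_x A x) = 0%E.
  apply: outer_null_bigcup => [|x]; first exact: countableP.
  apply: outer_nullU; last exact: ae_directional_additive.
  by apply: outer_nullU; [apply: outer_nullU|]; exact: ae_directional_derivative.
apply: le_lebesgue_outer => z; rewrite /rational_linear/= => /existsNP[q /existsNP[r h]].
exists (q, r) => //; rewrite /A/=.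
have [d1|] := pselect (derivable f z (rat_vec q)); last by move=> ?; do 3 left.
have [d2|] := pselect (derivable f z (rat_vec r)); last by move=> ?; left; left; right.
have [d3|] := pselect (derivable f z (rat_vec q + rat_vec r)); last by move=> ?; left; right.
by right; split => // h'; apply: h.
Qed.

Lemma rational_linearE z q : rational_linear z ->
  'D_(rat_vec q) f z = \sum_k ratr (q k) * 'D_(unit_vec k) f z.
Proof.
move=> rl; pose israt v := exists q, v = rat_vec q.
have ratD v w : israt v -> israt w -> israt (v + w).
  move=> [a ->] [b ->]; exists [ffun k => a k + b k].
  by apply: entryP => k; rewrite entryD !of_entryK ffunE rmorphD.
have rat0 : israt 0.
  by exists [ffun=> 0]; apply: entryP => k; rewrite entry0 of_entryK ffunE rmorph0.
have ratZ (a : rat) k : israt (ratr a *: unit_vec k).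
  exists [ffun j => a * (j == k)%:R]; apply: entryP => j.
  by rewrite entryZ !of_entryK ffunE rmorphM rmorph_nat.
have ratU k : israt (unit_vec k) by have := ratZ 1 k; rewrite rmorph1 scale1r.
have drat v : israt v -> derivable f z v by move=> [a ->]; exact: (rl a a).1.
have addrat v w : israt v -> israt w -> 'D_(v + w) f z = 'D_v f z + 'D_w f z.
  by move=> [a ->] [b ->]; exact: (rl a b).2.
have sumrat (s : seq I) : israt (\sum_(k <- s) ratr (q k) *: unit_vec k) /\
    'D_(\sum_(k <- s) ratr (q k) *: unit_vec k) f z = \sum_(k <- s) ratr (q k) * 'D_(unit_vec k) f z.
  elim: s => [|k s [IHr IH]]; rewrite ?big_nil ?big_cons.
    split => //; have [_] := directionalZ 0 (drat 0 rat0).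
    by rewrite scale0r mul0r.
  split; first by apply: ratD.
  by rewrite addrat// IH (directionalZ _ (drat _ (ratU k))).2.
rewrite [rat_vec q in LHS]sum_unit_vec.
under eq_bigr do rewrite of_entryK.
exact: (sumrat _).2.
Qed.

End Lipschitz.

(** * The Rademacher theorem *)

Lemma differentiable_eps {R : realType} {V W : normedModType R} (f : V -> W)
    (df : {linear V -> W}) (x : V) :
  continuous df ->
  (forall e : R, 0 < e -> \forall h \near 0, `|f (h + x) - f x - df h| <= e * `|h|) ->
  differentiable f x.
Proof.
move=> cdf fdf; have H : f \o shift x = cst (f x) + df +o_ 0 id.
  apply/eqaddoP => e e0; near=> h; rewrite /= !fctE opprD addrA.
  by near: h; exact: fdf.
by apply/diff_locallyP; rewrite (diff_unique cdf H).
Unshelve. all: by end_near. Qed.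

Section Rademacher.
Context {R : realType} {n p : nat}.
Local Notation E := ('cV[R]_n.+1 * 'M[R]_(n.+1, p))%type.
Local Notation I := ('I_n.+1 + 'I_n.+1 * 'I_p)%type.
Local Notation mu := (@lebesgue_outer R n.+1 p).

Definition linear_form (L : I -> R) (h : E) : R := \sum_k entry h k * L k.

Lemma linear_form_is_linear L : linear (linear_form L : E -> R).
Proof.
move=> a u v; rewrite /linear_form scaler_sumr -big_split/=; apply: eq_bigr => k _.
by rewrite entryD entryZ mulrDl -mulrA.
Qed.

HB.instance Definition _ L := GRing.isLinear.Build R E R *:%R (linear_form L)
  (linear_form_is_linear L).

Lemma linear_formBZ L h t v :
  linear_form L (h - t *: v) = linear_form L h - t * linear_form L v.
Proof.
rewrite /linear_form mulr_sumr -sumrB; apply: eq_bigr => k _.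
by rewrite entryB entryZ mulrBl mulrA.
Qed.

Lemma linear_form_le L h : `|linear_form L h| <= (\sum_k `|L k|) * `|h|.
Proof.
rewrite mulr_suml (le_trans (ler_norm_sum _ _ _))// ler_sum// => k _.
by rewrite normrM mulrC ler_wpM2l// entry_norm.
Qed.

Lemma linear_form_cont L : continuous (linear_form L).
Proof.
have M0 : 0 <= \sum_k `|L k| by apply: sumr_ge0.
apply: (@lipschitz_contE _ _ _ _ (\sum_k `|L k| + 1)) => [|z w]; first by rewrite ltr_wpDl.
by rewrite -linearB (le_trans (linear_form_le _ _))// ler_wpM2r// lerDl.
Qed.

(** Round every entry down to a multiple of [1 / N]. *)
Lemma grid_near (w : E) (N : nat) : (0 < N)%N -> `|w| <= 1 ->
  exists q : {ffun I -> 'I_(2 * N).+1},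
    `|w - rat_vec [ffun k => (q k)%:R / N%:R - 1]| <= N%:R^-1.
Proof.
move=> N0 w1; have NR0 : 0 < N%:R :> R by rewrite ltr0n.
have wk k : -1 <= entry w k <= 1 by rewrite -ler_norml (le_trans (entry_norm _ _)).
have a0 k : 0 <= N%:R * (entry w k + 1).
  by apply: mulr_ge0; [exact: ltW|have /andP[] := wk k; lra].
have small k : (Num.truncn (N%:R * (entry w k + 1)) < (2 * N).+1)%N.
  rewrite ltnS -(ler_nat R); have /andP[h _] := truncn_itv (a0 k); apply: (le_trans h).
  by rewrite natrM mulrC ler_wpM2r ?(ltW NR0)//; have /andP[] := wk k; lra.
exists [ffun k => Ordinal (small k)].
apply/norm_entryP => [|k]; first by rewrite invr_ge0 ltW.
rewrite entryB of_entryK ffunE rmorphB rmorph1 rmorphM fmorphV !rmorph_nat !ffunE/=.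
have /andP[h1 h2] := truncn_itv (a0 k).
move: h2; rewrite -natr1 => h2; set m := (Num.truncn _)%:R in h1 h2 *.
have -> : entry w k - (m / N%:R - 1) = (N%:R * (entry w k + 1) - m) / N%:R.
  by field; rewrite gt_eqF.
rewrite normrM normfV (gtr0_norm NR0) ler_pdivrMr// mulVf ?gt_eqF//.
by rewrite ler_norml; lra.
Qed.

(** The finitely many grid directions have a common scale below which the
    quotients are close to the linear form; any other direction is within
    [1 / N] of the grid, at a cost controlled by the Lipschitz constant. *)
Lemma rational_linear_differentiable (f : E -> R) K z : 0 < K ->
  (forall z w : E, `|f z - f w| <= K * `|z - w|) ->
  rational_linear f z -> differentiable f z.
Proof.
move=> K0 lipf rl; pose L k := 'D_(unit_vec k) f z.
apply: (@differentiable_eps _ _ _ f (linear_form L)); first exact: linear_form_cont.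
move=> e e0; set M := \sum_k `|L k|.
have M0 : 0 <= M by apply: sumr_ge0.
have KM : 0 < K + M by rewrite ltr_pwDl.
have [N Ne] : exists N, N.+1%:R^-1 < e / 2 / (K + M) by apply: natSinv_lt; rewrite !divr_gt0.
pose vec (q : {ffun I -> 'I_(2 * N.+1).+1}) : E := rat_vec [ffun k => (q k)%:R / N.+1%:R - 1].
have near_all : \forall t \near 0^', forall q, `|linear_form L (vec q) - slope f (vec q) z t| <= e / 2.
  apply: filter_forall => q.
  have /derivable_slopeP/cvgrPdist_le := conj (rl [ffun k => (q k)%:R / N.+1%:R - 1] [ffun=> 0]).1
     (erefl ('D_(vec q) f z)).
  rewrite (rational_linearE _ rl) /linear_form.
  under [X in _ -> \forall t \near _, `|X - _| <= _]eq_bigr do rewrite of_entryK.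
  by apply; rewrite divr_gt0.
have /nbhs_ballP[d /= d0 dP] := near_all.
apply/nbhs_ballP; exists d => //= h; rewrite -ball_normE /= sub0r normrN => hd.
have [->|hn0] := eqVneq h 0.
  by rewrite add0r subrr linear0 subrr !normr0 mulr0.
have t0 : 0 < `|h| by rewrite normr_gt0.
set t := `|h| in t0 hd *.
have w1 : `|t^-1 *: h| <= 1 by rewrite normrZ normfV normr_id mulVf ?gt_eqF.
have [q hq] := grid_near (isT : (0 < N.+1)%N) w1; rewrite -/(vec q) in hq.
have := dP t; rewrite /ball/= sub0r normrN (gtr0_norm t0) gt_eqF// => /(_ hd isT q) h1.
have hqt : `|h - t *: vec q| <= t * N.+1%:R^-1.
  have -> : h - t *: vec q = t *: (t^-1 *: h - vec q).
    by rewrite scalerBr scalerA mulfV ?gt_eqF// scale1r.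
  by rewrite normrZ gtr0_norm// ler_wpM2l// ltW.
have h2 : `|f (z + h) - f (z + t *: vec q)| <= K * (t * N.+1%:R^-1).
  rewrite (le_trans (lipf _ _))// ler_wpM2l ?(ltW K0)//.
  by rewrite opprD addrACA subrr add0r.
have h3 : `|linear_form L h - t * linear_form L (vec q)| <= M * (t * N.+1%:R^-1).
  have -> : linear_form L h - t * linear_form L (vec q) = linear_form L (h - t *: vec q).
    by rewrite linear_formBZ.
  by rewrite (le_trans (linear_form_le _ _))// ler_wpM2l.
have h4 : `|f (z + t *: vec q) - f z - t * linear_form L (vec q)| <= e / 2 * t.
  have -> : f (z + t *: vec q) - f z - t * linear_form L (vec q) =
      t * (slope f (vec q) z t - linear_form L (vec q)).
    by rewrite /slope; field; rewrite gt_eqF.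
  by rewrite normrM gtr0_norm// mulrC ler_wpM2r ?(ltW t0)// distrC.
rewrite (addrC h).
have -> : f (z + h) - f z - linear_form L h = (f (z + h) - f (z + t *: vec q)) +
   (f (z + t *: vec q) - f z - t * linear_form L (vec q)) -
   (linear_form L h - t * linear_form L (vec q)) by ring.
rewrite (le_trans (ler_normB _ _))// (le_trans (lerD (ler_normD _ _) (lexx _)))//.
rewrite (le_trans (lerD (lerD h2 h4) h3))//.
move: Ne; rewrite ltr_pdivlMr// => /ltW; rewrite -(ler_pM2r t0).
move: (N.+1%:R^-1) => iN; lra.
Qed.

Lemma rademacher (f : E -> R) K : 
  (forall z w : E, `|f z - f w| <= K * `|z - w|) ->
  mu [set z | ~ differentiable f z] = 0%E.
Proof.
move=> lipf; have K0 : 0 < `|K| + 1 by rewrite ltr_wpDl.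
have lipf' z w : `|f z - f w| <= (`|K| + 1) * `|z - w|.
  rewrite (le_trans (lipf _ _))// ler_wpM2r//.
  by rewrite (le_trans (ler_norm K))// lerDl.
apply/eqP; rewrite eq_le lebesgue_outer_ge0 andbT -(ae_rational_linear K0 lipf').
apply: le_lebesgue_outer => z /=; apply: contra_not.
exact: rational_linear_differentiable K0 lipf'.
Qed.

Definition clamp (M : R) (z : E) : E :=
  of_entry (fun k => Num.max (- M) (Num.min (entry z k) M)).

Lemma clamp_lip M z w : `|clamp M z - clamp M w| <= `|z - w|.
Proof.
apply/norm_entryP => // k; rewrite entryB !of_entryK.
apply: le_trans (entry_norm (z - w) k); rewrite entryB.
move: (entry z k) (entry w k) => a b; rewrite !maxEle !minEle.
by repeat case: ifPn; rewrite -?ltNge => *; rewrite ?subrr ?normr0//;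
  case: (ler0P (_ - _)) => ?; case: (ler0P (_ - _)) => ?; lra.
Qed.

Lemma clamp_norm M z : 0 <= M -> `|clamp M z| <= M.
Proof.
move=> M0; apply/norm_entryP => // k; rewrite of_entryK ler_norml le_max lexx/=.
by rewrite ge_max ge_min lexx orbT andbT; lra.
Qed.

Lemma clamp_id M z : `|z| <= M -> clamp M z = z.
Proof.
move=> zM; apply: entryP => k; rewrite of_entryK.
have := le_trans (entry_norm z k) zM; rewrite ler_norml => /andP[h1 h2].
by rewrite min_l// max_r.
Qed.

(** Truncating the entries extends a Lipschitz function on a ball of the
    maximum norm to the whole space without changing it inside the ball. *)
Lemma rademacher_local (f : E -> R) (K : R -> R) :
  (forall M (z w : E), `|z| <= M -> `|w| <= M -> `|f z - f w| <= K M * `|z - w|) ->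
  mu [set z | ~ differentiable f z] = 0%E.
Proof.
move=> lipf; apply/eqP; rewrite eq_le lebesgue_outer_ge0 andbT.
pose A (m : nat) : set E := [set z | ~ differentiable (f \o clamp m%:R) z].
have <- : mu (\bigcup_m A m) = 0%E.
  apply: outer_null_bigcup => [|m]; first exact: countableP.
  apply: (@rademacher _ `|K m%:R|) => z w /=.
  rewrite (le_trans (lipf m%:R _ _ _ _)) ?clamp_norm//.
  apply: (le_trans (ler_wpM2r (normr_ge0 _) (ler_norm _))).
  by rewrite ler_wpM2l// clamp_lip.
apply: le_lebesgue_outer => z /= nd; pose m := Num.bound `|z|.
have zm : `|z| < m%:R by apply: archi_boundP.
exists m => //; rewrite /A/=; apply: contra_not nd => dz.
have fE : \forall w \near z, (f \o clamp m%:R) w = f w.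
  near=> w; rewrite /= clamp_id// ltW//; near: w.
  by apply: cvgr_lt zm; apply: cvg_norm; exact: cvg_id.
apply: (@differentiable_eps _ _ _ f ('d (f \o clamp m%:R) z)); first exact: diff_continuous.
move=> e e0; have /eqaddoP/(_ e e0) de := diff_locally dz.
have := fE; rewrite (near_shift 0 z) => fE0.
near=> h; rewrite -(nbhs_singleton fE).
have <- : (f \o clamp m%:R) (h + z) = f (h + z).
  by near: h; apply: filterS fE0 => h /=; rewrite subr0.
have : `|((f \o clamp m%:R) \o shift z - (cst ((f \o clamp m%:R) z) + 'd (f \o clamp m%:R) z)) h| <= e * `|h|.
  by near: h; exact: de.
by rewrite !fctE opprD addrA.
Unshelve. all: by end_near. Qed.

End Rademacher.

(** * Quadratic forms and a weighted pseudo-inverse *)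

Section QuadraticForm.
Context {R : realType} {p : nat}.
Implicit Types (S : 'M[R]_p) (u v w : 'cV[R]_p).

Definition bform S u v : R := (u^T *m S *m v) 0 0.
Definition qform S v := bform S v v.

Lemma bformDl S u v w : bform S (u + v) w = bform S u w + bform S v w.
Proof. by rewrite /bform linearD/= !mulmxDl mxE. Qed.

Lemma bformDr S u v w : bform S u (v + w) = bform S u v + bform S u w.
Proof. by rewrite /bform !mulmxDr mxE. Qed.

Lemma bformZl S a u v : bform S (a *: u) v = a * bform S u v.
Proof. by rewrite /bform linearZ/= -!scalemxAl mxE. Qed.

Lemma bformZr S a u v : bform S u (a *: v) = a * bform S u v.
Proof. by rewrite /bform -!scalemxAr mxE. Qed.

Lemma bformC S u v : S^T = S -> bform S u v = bform S v u.
Proof.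
move=> sS; rewrite /bform -[in LHS]sS -[v in LHS]trmxK -trmx_mul -trmx_mul mulmxA.
by rewrite mxE.
Qed.

Lemma qformD S u v : S^T = S -> qform S (u + v) = qform S u + 2 * bform S u v + qform S v.
Proof.
by move=> sS; rewrite /qform bformDl !bformDr (bformC v u sS); ring.
Qed.

Lemma qformZ S a v : qform S (a *: v) = a ^+ 2 * qform S v.
Proof. by rewrite /qform bformZl bformZr; ring. Qed.

Lemma qform_conv S t u v : S^T = S ->
  qform S (t *: u + (1 - t) *: v) =
  t * qform S u + (1 - t) * qform S v - t * (1 - t) * qform S (u - v).
Proof.
move=> sS; have -> : u - v = u + (-1) *: v by rewrite scaleN1r.
by rewrite !qformD// !qformZ !bformZl !bformZr; ring.
Qed.

Lemma qform_ge0 S v : is_covariance S -> 0 <= qform S v.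
Proof. by case=> _; exact. Qed.

(** The form is nonnegative at [q(v) u - b(u, v) v]; when [q(v) = 0], at
    [b(u, v) u - (1 + q(u)) v]. *)
Lemma cauchy_schwarz S u v : is_covariance S ->
  bform S u v ^+ 2 <= qform S u * qform S v.
Proof.
move=> cS; have sS := cS.1.
have qE a b : qform S (a *: u + b *: v) =
    a ^+ 2 * qform S u + 2 * a * b * bform S u v + b ^+ 2 * qform S v.
  by rewrite qformD// !qformZ bformZl bformZr; ring.
have [qv0|qv0] := eqVneq (qform S v) 0.
  have : 0 <= qform S (bform S u v *: u + (- (1 + qform S u)) *: v) by exact: qform_ge0.
  rewrite qE qv0 !mulr0 addr0; have := qform_ge0 u cS.
  move: (bform S u v) (qform S u) => b q q0 h.
  have : b ^+ 2 * (q + 2) <= 0 by nra.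
  by rewrite pmulr_lle0//; lra.
have qv : 0 < qform S v by rewrite lt_neqAle eq_sym qv0 qform_ge0.
have : 0 <= qform S (qform S v *: u + (- bform S u v) *: v) by exact: qform_ge0.
rewrite qE; move: (bform S u v) (qform S u) (qform S v) qv => b q r r0 h.
have : 0 <= r * (q * r - b ^+ 2) by apply: le_trans h _; rewrite le_eqVlt; apply/orP; left; apply/eqP; ring.
by rewrite pmulr_rge0// subr_ge0.
Qed.

Lemma covariance1 : is_covariance (1%:M : 'M[R]_p).
Proof.
split; first exact: trmx1.
move=> v; rewrite mulmx1 mxE sumr_ge0// => i _.
by rewrite mxE -expr2 sqr_ge0.
Qed.

Lemma bformE S u v : bform S u v = \sum_i u i 0 * (S *m v) i 0.
Proof. by rewrite /bform -mulmxA mxE; apply: eq_bigr => i _; rewrite mxE. Qed.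

Lemma qform_eq0 S v : is_covariance S -> S \in unitmx -> qform S v = 0 -> v = 0.
Proof.
move=> cS uS qv0; have Sv0 : S *m v = 0.
  apply/matrixP => i j; rewrite ord1 [RHS]mxE.
  have := cauchy_schwarz (delta_mx i 0) v cS; rewrite qv0 mulr0.
  rewrite bformE (bigD1 i)//= big1 ?addr0 => [|k ki]; rewrite mxE ?eqxx ?mul1r.
    by move=> h; apply/eqP; rewrite -sqrf_eq0 eq_le h sqr_ge0.
  by rewrite (negPf ki) mul0r.
by rewrite -[v](mulKmx uS) Sv0 mulmx0.
Qed.

Lemma covariance_inv S : is_covariance S -> S \in unitmx -> is_covariance (invmx S).
Proof.
move=> cS uS; split; first by rewrite trmx_inv cS.1.
move=> v; have := qform_ge0 (invmx S *m v) cS.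
by rewrite /qform /bform trmx_mul trmx_inv cS.1 -!mulmxA mulKVmx.
Qed.

(** The entry [v_j] is the product of [S^-1 e_j] and [v] for the form [S]. *)
Lemma entry_le_qform S v j : is_covariance S -> S \in unitmx ->
  v j 0 ^+ 2 <= invmx S j j * qform S v.
Proof.
move=> cS uS; have := cauchy_schwarz (invmx S *m delta_mx j 0) v cS.
have -> : bform S (invmx S *m delta_mx j 0) v = v j 0.
  rewrite /bform trmx_mul trmx_inv cS.1 -!mulmxA mulKmx// trmx_delta.
  by rewrite -rowE mxE.
have -> : qform S (invmx S *m delta_mx j 0) = invmx S j j => //.
by rewrite /qform /bform trmx_mul trmx_inv cS.1 -!mulmxA mulKVmx// trmx_delta -rowE mxE -colE mxE.
Qed.

Lemma norm_le_qform S : is_covariance S -> S \in unitmx ->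
  exists2 C, 0 < C & forall v, `|v| ^+ 2 <= C * qform S v.
Proof.
move=> cS uS; pose C := \sum_j invmx S j j + 1.
have Tj j : 0 <= invmx S j j.
  have := qform_ge0 (delta_mx j 0) (covariance_inv cS uS).
  by rewrite /qform bformE (bigD1 j)//= big1 ?addr0 => [|k kj];
    rewrite mxE ?eqxx ?mul1r -?colE ?mxE// (negPf kj) mul0r.
exists C => [|v]; first by rewrite ltr_wpDl// sumr_ge0.
have q0 := qform_ge0 v cS.
have C0 : 0 <= C by rewrite addr_ge0// sumr_ge0.
rewrite -[leRHS]sqr_sqrtr ?mulr_ge0// ler_sqr ?nnegrE ?sqrtr_ge0//.
rewrite [leLHS]/Num.norm/= mx_normrE; apply: bigmax_le; first exact: sqrtr_ge0.
move=> [j k] _ /=; rewrite ord1 -ler_sqr ?nnegrE ?sqrtr_ge0// sqr_sqrtr ?mulr_ge0//.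
rewrite real_normK ?num_real// (le_trans (entry_le_qform _ _ cS uS))//.
rewrite ler_wpM2r// /C (bigD1 j)//= -addrA lerDl addr_ge0// sumr_ge0//.
Qed.

End QuadraticForm.

Lemma opnorm_le {R : realType} {m n : nat} (M : 'M[R]_(m, n)) (c : R) : 0 <= c ->
  (forall v : 'cV[R]_n, qform 1%:M (M *m v) <= c ^+ 2 * qform 1%:M v) -> opnorm M <= c.
Proof.
move=> c0 Mc; have bnd s : singular_value M s -> s <= c.
  move=> [s0 /eigenvalueP[v vM v0]].
  rewrite -ler_sqr ?nnegrE//; have := Mc v^T.
  have -> : qform 1%:M (M *m v^T) = s ^+ 2 * qform 1%:M v^T.
    rewrite /qform /bform mulmx1 trmx_mul trmxK mulmxA -(mulmxA v) vM.
    by rewrite -scalemxAl mxE mulmx1.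
  rewrite ler_pM2r// lt_neqAle qform_ge0 ?andbT; last exact: covariance1.
  rewrite eq_sym; apply: contra v0 => /eqP q0; apply/eqP.
  by rewrite -[v]trmxK (qform_eq0 covariance1 (unitmx1 _ _) q0) trmx0.
rewrite /opnorm; have [E0|/set0P ne] := eqVneq (singular_value M) set0.
  (* an empty supremum is 0 *)
  by rewrite E0 sup0.
by apply: ge_sup => // s /bnd.
Qed.

Section WeightedPseudoInverse.
Context {R : realType} {p N : nat}.
Variables (S : 'M[R]_p) (Q B : 'M[R]_(p, N)) (kappa : R).
Hypotheses (cS : is_covariance S) (uS : S \in unitmx) (kappa0 : 0 < kappa).
Hypothesis monoQB : forall c : 'cV[R]_N,
  kappa * qform S (B *m c) <= ((B *m c)^T *m (Q *m c)) 0 0.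

(** [B] kills the kernel of [Q], hence factors through [Q]; the factor is then
    composed with the projection onto the range of [Q] that is orthogonal for
    the form of the inverse of [S], which does not increase that form. *)
Lemma weighted_factor : exists A : 'M[R]_p, A *m Q = B /\
  forall v : 'cV[R]_p, exists c : 'cV[R]_N,
    A *m v = B *m c /\ qform (invmx S) (Q *m c) <= qform (invmx S) v.
Proof.
have [A0 A0E] : exists A0, B = A0 *m Q.
  apply/submxP; rewrite submxE; apply/eqP/matrixP => i j; rewrite [RHS]mxE.
  pose c := col j (cokermx Q).
  have Qc : Q *m c = 0 by rewrite /c colE mulmxA mulmx_coker mul0mx.
  have := monoQB c; rewrite Qc mulmx0 [leRHS]mxE pmulr_rle0// => q0.
  have /(qform_eq0 cS uS) : qform S (B *m c) = 0.
    by apply/eqP; rewrite eq_le q0 qform_ge0.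
  by rewrite /c colE mulmxA -colE => /matrixP/(_ i 0); rewrite !mxE.
pose T := invmx S; have cT : is_covariance T by exact: covariance_inv.
have uT : T \in unitmx by rewrite unitmx_inv.
pose Q' := col_base Q; pose G := Q'^T *m T *m Q'.
have uG : G \in unitmx.
  rewrite -row_free_unit -kermx_eq0; apply/rowV0P => u /sub_kermxP uG0.
  have Qu0 : Q' *m u^T = 0.
    apply: (qform_eq0 cT uT); rewrite /qform /bform trmx_mul trmxK.
    have -> : u *m Q'^T *m T *m (Q' *m u^T) = u *m G *m u^T by rewrite /G !mulmxA.
    by rewrite uG0 mul0mx mxE.
  have /row_freeP[L LE] : row_free Q'^T.
    by rewrite /row_free mxrank_tr; have := col_base_full Q; rewrite /row_full.
  have : u *m Q'^T = 0 by rewrite -[u]trmxK -trmx_mul Qu0 trmx0.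
  by move=> /(congr1 (mulmx^~ L)); rewrite -mulmxA LE mulmx1 mul0mx.
pose P := Q' *m invmx G *m Q'^T *m T.
have PQ' : P *m Q' = Q'.
  by rewrite /P -!mulmxA (mulmxA Q'^T T) -/G mulVmx// mulmx1.
have PQ : P *m Q = Q.
  by rewrite -(mulmx_base Q) mulmxA -/Q' PQ'.
have PTP : P^T *m T *m (1%:M - P) = 0.
  have -> : P^T *m T = T *m Q' *m (invmx G)^T *m Q'^T *m T.
    by rewrite /P !trmx_mul !trmxK cT.1 !mulmxA.
  have QP : Q'^T *m T *m P = Q'^T *m T.
    have -> : Q'^T *m T *m P = G *m invmx G *m Q'^T *m T by rewrite /P /G !mulmxA.
    by rewrite mulmxV// mul1mx.
  rewrite mulmxBr mulmx1; apply/eqP; rewrite subr_eq0; apply/eqP.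
  set M := T *m Q' *m (invmx G)^T; by rewrite -[in LHS](mulmxA M) -QP !mulmxA.
exists (A0 *m P); split; first by rewrite -mulmxA PQ -A0E.
move=> v; have [X XE] : exists X, Q' = Q *m X.
  have /row_fullP[L LE] : row_full (row_base Q)^T.
    by rewrite /row_full mxrank_tr; have := row_base_free Q; rewrite /row_free.
  exists L^T; rewrite -[LHS]mulmx1 -(trmx1 _ (\rank Q)) -LE trmx_mul trmxK mulmxA.
  by rewrite mulmx_base.
exists (X *m invmx G *m Q'^T *m T *m v).
have -> : Q *m (X *m invmx G *m Q'^T *m T *m v) = P *m v by rewrite /P XE !mulmxA.
split; first by rewrite A0E /P XE !mulmxA.
have -> : qform T v = qform T (P *m v) + qform T (v - P *m v).
  have vE : v = P *m v + (v - P *m v) by rewrite addrC subrK.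
  rewrite [in LHS]vE (qformD (P *m v) _ cT.1).
  suff -> : bform T (P *m v) (v - P *m v) = 0 by rewrite mulr0 addr0.
  rewrite /bform trmx_mul -[X in _ *m (X - _)]mul1mx -mulmxBl.
  have -> : v^T *m P^T *m T *m ((1%:M - P) *m v) = v^T *m (P^T *m T *m (1%:M - P)) *m v.
    by rewrite !mulmxA.
  by rewrite PTP mulmx0 mul0mx mxE.
by rewrite lerDl qform_ge0.
Qed.

(** For a symmetric square root [T] of [S] and [b = A T v = B c], the hypothesis
    bounds [kappa |T b|^2] by the product of [T b] and [T^-1 Q c], and the
    projection makes [|T^-1 Q c| <= |v|]. *)
Lemma weighted_factor_opnorm : exists A : 'M[R]_p, A *m Q = B /\
  opnorm (psd_sqrt S *m A *m psd_sqrt S) <= kappa^-1.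
Proof.
have [A [AQ Av]] := weighted_factor; exists A; split => //.
apply: opnorm_le; first by rewrite invr_ge0 ltW.
rewrite /psd_sqrt; case: xgetP => [T _ [cT TT]|_] v; last first.
  (* the default value 0 of the square root *)
  rewrite !mul0mx /qform /bform mulmx0 [leLHS]mxE.
  by rewrite mulr_ge0 ?sqr_ge0// qform_ge0//; exact: covariance1.
have uT : T \in unitmx by move: uS; rewrite -TT unitmx_mul andbb.
have iS : invmx S = invmx T *m invmx T.
  have h : invmx T *m invmx T *m S = 1%:M by rewrite -TT mulmxA mulmxKV// mulVmx.
  by rewrite -[LHS]mul1mx -h mulmxK.
have [c [Ac Qc]] := Av (T *m v).
have q1 u : qform 1%:M (T *m u) = qform S u.
  by rewrite /qform /bform mulmx1 trmx_mul cT.1 -TT !mulmxA.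
have qT : qform (invmx S) (T *m v) = qform 1%:M v.
  by rewrite iS /qform /bform trmx_mul cT.1 mulmx1 !mulmxA mulmxK// mulmxKV.
pose b := B *m c; pose w := Q *m c.
have -> : T *m A *m T *m v = T *m b by rewrite /b -Ac !mulmxA.
have bw : (b^T *m w) 0 0 = bform 1%:M (T *m b) (invmx T *m w).
  by rewrite /bform mulmx1 (trmx_mul T) cT.1 -mulmxA mulKVmx.
have qw : qform 1%:M (invmx T *m w) <= qform 1%:M v.
  have -> : qform 1%:M (invmx T *m w) = qform (invmx S) w.
    by rewrite iS /qform /bform mulmx1 (trmx_mul (invmx T)) trmx_inv cT.1 !mulmxA.
  by rewrite -qT.
have h1 := monoQB c; rewrite -/b -/w bw -q1 in h1.
have h2 := cauchy_schwarz (T *m b) (invmx T *m w) covariance1.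
have := qform_ge0 (T *m b) covariance1; move: h1 h2 qw.
have := qform_ge0 v covariance1.
move: (qform 1%:M v) (qform 1%:M (T *m b)) (bform _ _ _) (qform _ (invmx T *m w)).
move=> vv al xy be vv0 h1 h2 qw al0; rewrite exprVn ler_pdivlMl ?exprn_gt0//.
have [->|aln0] := eqVneq al 0; first by rewrite mulr0.
have {aln0}al0' : 0 < al by rewrite lt_neqAle eq_sym aln0.
rewrite -(ler_pM2r al0').
have h3 : (kappa * al) ^+ 2 <= xy ^+ 2.
  by rewrite ler_sqr ?nnegrE ?mulr_ge0 ?(le_trans _ h1) ?mulr_ge0// ltW.
apply: le_trans (le_trans h3 (le_trans h2 _)).
  by rewrite le_eqVlt; apply/orP; left; apply/eqP; ring.
by rewrite mulrC ler_wpM2r.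
Qed.

End WeightedPseudoInverse.

(** * Convex functions on a finite-dimensional space *)

Definition convex_ineq {R : realType} {V : lmodType R} (f : V -> R) := forall t x y,
  0 <= t <= 1 -> f (t *: x + (1 - t) *: y) <= t * f x + (1 - t) * f y.

Lemma convex_functionE {R : realType} {V : lmodType R} (f : V -> R) :
  convex_function [set: V] (f : V -> R^o) -> convex_ineq f.
Proof.
move=> cf t x y /andP[t0 t1].
by have := cf (Itv01 t0 t1) x y (in_setT x) (in_setT y).
Qed.

Lemma norm_colP {R : realType} {p : nat} (v : 'cV[R]_p) r : 0 <= r ->
  reflect (forall j, `|v j 0| <= r) (`|v| <= r).
Proof.
move=> r0; apply: (iffP idP) => [vr j|h].
  by apply: le_trans vr; rewrite [leRHS]/Num.norm/= mx_normrE (le_bigmax _ _ (j, 0)).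
by rewrite [leLHS]/Num.norm/= mx_normrE; apply: bigmax_le => // -[j k] _ /=; rewrite ord1.
Qed.

Lemma col_norm {R : realType} {p : nat} (v : 'cV[R]_p) j : `|v j 0| <= `|v|.
Proof. exact: (norm_colP v (normr_ge0 v) (lexx _)). Qed.

Section ConvexContinuous.
Context {R : realType} {p : nat}.
Local Notation V := ('cV[R]_p).
Variables (h : V -> R).
Hypothesis ch : convex_ineq h.

Lemma convex_le_max t x y : 0 <= t <= 1 ->
  h (t *: x + (1 - t) *: y) <= Num.max (h x) (h y).
Proof.
move=> t01; apply: (le_trans (ch _ _ t01)); have /andP[t0 t1] := t01.
have hx : h x <= Num.max (h x) (h y) by rewrite le_max lexx.
have hy : h y <= Num.max (h x) (h y) by rewrite le_max lexx orbT.
have -> : Num.max (h x) (h y) = t * Num.max (h x) (h y) + (1 - t) * Num.max (h x) (h y) by ring.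
by apply: lerD; apply: ler_wpM2l => //; lra.
Qed.

(** The value at a point of a cube is at most the largest value at the
    vertices; the coordinates are moved to the faces one at a time. *)
Lemma convex_bounded_cube (s : seq 'I_p) x0 : exists M, forall a : 'I_p -> R,
  (forall j, `|a j| <= 1) -> h (x0 + \sum_(j <- s) a j *: delta_mx j 0) <= M.
Proof.
elim: s x0 => [|k s IH] x0.
  by exists (h x0) => a _; rewrite big_nil addr0.
have [M1 h1] := IH (x0 + delta_mx k 0); have [M2 h2] := IH (x0 - delta_mx k 0).
exists (Num.max M1 M2) => a a1; rewrite big_cons; set S := \sum_(j <- s) _.
have -> : x0 + (a k *: delta_mx k 0 + S) =
    ((1 + a k) / 2) *: (x0 + delta_mx k 0 + S) + (1 - (1 + a k) / 2) *: (x0 - delta_mx k 0 + S).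
  by apply/matrixP => i j; rewrite !mxE; field.
have ak := a1 k; rewrite ler_norml in ak; have /andP[k0 k1] := ak.
apply: (le_trans (convex_le_max _ _ _)); first by apply/andP; split; lra.
rewrite ge_max !le_max; apply/andP; split; apply/orP.
  by left; exact: h1.
by right; exact: h2.
Qed.

Lemma col_sum_delta (v : V) : v = \sum_j v j 0 *: delta_mx j 0.
Proof. by rewrite [LHS]matrix_sum_delta; apply: eq_bigr => i _; rewrite big_ord1. Qed.

(** Bounded above by [M] on the unit ball around [x0], convexity along the
    segments through [x0] bounds the increments in both directions. *)
Lemma convex_increment x0 : exists2 K, 0 <= K &
  forall v, `|v| <= 1 -> `|h (x0 + v) - h x0| <= K * `|v|.
Proof.
have [M hM] := convex_bounded_cube (index_enum 'I_p) x0.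
have hMv v : `|v| <= 1 -> h (x0 + v) <= M.
  move=> v1; rewrite [v]col_sum_delta; apply: (hM (fun j => v j 0)) => j.
  exact: le_trans (col_norm v j) v1.
have M0 : h x0 <= M by have := hMv 0; rewrite normr0 addr0; apply.
have up v : `|v| <= 1 -> h (x0 + v) - h x0 <= (M - h x0) * `|v|.
  move=> v1; have [->|v0] := eqVneq v 0; first by rewrite addr0 subrr normr0 mulr0.
  have nv0 : 0 < `|v| by rewrite normr_gt0.
  have -> : x0 + v = `|v| *: (x0 + `|v|^-1 *: v) + (1 - `|v|) *: x0.
    by apply/matrixP => i j; rewrite !mxE; field; rewrite gt_eqF.
  have := ch (x0 + `|v|^-1 *: v) x0 (_ : 0 <= `|v| <= 1); rewrite v1 ltW// => /(_ isT) h1.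
  have : h (x0 + `|v|^-1 *: v) <= M.
    by apply: hMv; rewrite normrZ normfV normr_id mulVf ?gt_eqF.
  by rewrite -(ler_pM2l nv0); lra.
exists (M - h x0) => [|v v1]; first by rewrite subr_ge0.
rewrite ler_norml up// andbT.
have := up (- v); rewrite normrN => /(_ v1).
have half01 : 0 <= (1 / 2 : R) <= 1 by apply/andP; split; lra.
have := ch (x0 + v) (x0 - v) half01.
have -> : (1 / 2) *: (x0 + v) + (1 - 1 / 2) *: (x0 - v) = x0.
  by apply/matrixP => i j; rewrite !mxE; field.
lra.
Qed.

Lemma convex_continuous : continuous h.
Proof.
move=> x; have [K K0 hK] := convex_increment x.
apply/(@cvgrPdist_le _ _ _ (nbhs x)) => e e0; have K1 : 0 < K + 1 by rewrite ltr_wpDl.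
have d0 : 0 < Num.min 1 (e / (K + 1)) by rewrite lt_min ltr01 divr_gt0.
apply/nbhs_ballP; exists (Num.min 1 (e / (K + 1))) => // y.
rewrite -ball_normE /= lt_min => /andP[/ltW xy1 /ltW xye].
have := hK (y - x); rewrite distrC xy1 (addrC x) subrK => /(_ isT).
rewrite (distrC (h y)) => hy; apply: (le_trans hy).
apply: (@le_trans _ _ ((K + 1) * `|x - y|)); first by rewrite ler_wpM2r// lerDl.
by rewrite mulrC -ler_pdivlMr.
Qed.

End ConvexContinuous.

Section Existence.
Context {R : realType} {p : nat}.
Local Notation V := ('cV[R]_p).

Lemma trmx_cont : continuous (trmx : 'rV[R]_p -> 'cV[R]_p).
Proof.
move=> x; apply/(@cvgrPdist_le _ _ _ (nbhs x)) => e e0.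
apply/nbhs_ballP; exists e => // y; rewrite -ball_normE /= => /ltW xy.
apply/norm_colP => [|j]; first exact: ltW.
rewrite !mxE; apply: le_trans xy.
by rewrite [leRHS]/Num.norm/= mx_normrE (le_trans _ (le_bigmax _ _ (0, j)))// !mxE.
Qed.

Lemma coercive_has_min (F : V -> R) B : 0 <= B -> continuous F ->
  (forall b, B <= `|b| -> F 0 <= F b) -> exists b0, forall b, F b0 <= F b.
Proof.
move=> B0 cF FB.
pose K : set 'rV[R]_p := [set v | forall i, `[- B, B]%classic (v ord0 i)].
have cK : compact K.
  by apply: (rV_compact (A := fun=> `[- B, B]%classic)) => i; exact: segment_compact.
have K0 : K 0 by move=> i /=; rewrite mxE in_itv/= oppr_le0 B0.
have cG : continuous (fun v : 'rV[R]_p => F v^T).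
  by move=> v; apply: continuous_comp; [exact: trmx_cont|exact: cF].
have [c _ cmin] := compact_EVT_min (ex_intro _ 0 K0) cK (continuous_subspaceT cG).
exists c^T => b; have [/ltW bB|/FB] := ltP `|b| B; last first.
  by apply: le_trans; have := cmin 0; rewrite trmx0; apply; rewrite inE.
have := cmin b^T; rewrite trmxK; apply; rewrite inE => i /=.
by rewrite mxE in_itv/= -ler_norml (le_trans (col_norm b i)).
Qed.

Lemma qform_convex (S : 'M[R]_p) a : is_covariance S -> 0 <= a ->
  convex_ineq (fun b => a * qform S b).
Proof.
move=> cS a0 t x y /andP[t0 t1]; rewrite qform_conv ?cS.1//.
have : 0 <= a * (t * (1 - t)) * qform S (x - y).
  by rewrite mulr_ge0 ?qform_ge0// !mulr_ge0// subr_ge0.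
by lra.
Qed.

Lemma convex_ineqD (f g : V -> R) : convex_ineq f -> convex_ineq g ->
  convex_ineq (fun b => f b + g b).
Proof. by move=> cf cg t x y t01; have := cf t x y t01; have := cg t x y t01; lra. Qed.

(** A convex function is bounded below by an affine function of the norm, and
    is therefore dominated by the quadratic term at infinity. *)
Lemma strongly_convex_has_min (h : V -> R) (S : 'M[R]_p) a :
  is_covariance S -> S \in unitmx -> 0 < a -> convex_ineq h ->
  exists b0, forall b, h b0 + a * qform S b0 <= h b + a * qform S b.
Proof.
move=> cS uS a0 ch; have [C C0 hC] := norm_le_qform cS uS.
have [K K0 hK] := convex_increment ch 0.
have B0 : 0 <= K * C / a by rewrite divr_ge0 ?mulr_ge0 ?(ltW a0) ?(ltW C0).
apply: (@coercive_has_min (fun b => h b + a * qform S b) (1 + K * C / a)).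
- by rewrite addr_ge0.
- apply: convex_continuous; apply: convex_ineqD => //.
  by apply: qform_convex => //; exact: ltW.
move=> b bB; have b1 : 1 <= `|b| by apply: le_trans bB; rewrite lerDl.
have bp : 0 < `|b| by apply: lt_le_trans b1.
have q0 : qform S 0 = 0 by rewrite /qform /bform mulmx0 mxE.
rewrite q0 mulr0 addr0.
have h1 : - K <= h (`|b|^-1 *: b) - h 0.
  have := hK (`|b|^-1 *: b); rewrite add0r normrZ normfV normr_id mulVf ?gt_eqF// lexx mulr1.
  by move=> /(_ isT); rewrite ler_norml => /andP[].
have h2 : h (`|b|^-1 *: b) <= `|b|^-1 * h b + (1 - `|b|^-1) * h 0.
  have inv01 : 0 <= `|b|^-1 <= 1 by rewrite invr_ge0 normr_ge0 invf_le1.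
  by have := ch _ b 0 inv01; rewrite scaler0 addr0.
have h3 : h 0 - K * `|b| <= h b.
  have : `|b| * (- K) <= `|b| * (`|b|^-1 * h b + (1 - `|b|^-1) * h 0 - h 0).
    by rewrite ler_pM2l//; lra.
  have -> : `|b| * (`|b|^-1 * h b + (1 - `|b|^-1) * h 0 - h 0) = h b - h 0.
    by field; rewrite gt_eqF.
  lra.
have h4 : K * `|b| <= a * qform S b.
  rewrite -(ler_pM2l C0) mulrCA; apply: (@le_trans _ _ (a * `|b| ^+ 2)); last first.
    by rewrite [leRHS]mulrCA ler_wpM2l ?hC// ltW.
  rewrite expr2 !mulrA ler_wpM2r// -ler_pdivrMl// (le_trans _ bB)//.
  by rewrite mulrC lerDr.
lra.
Qed.

End Existence.

(** * The scalar loss and its score function *)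

Section ScalarDerivative.
Context {R : realType}.
Implicit Types (f : R -> R) (u : R).

Lemma derive1_cvg f u : derivable f u 1 ->
  h^-1 * (f (u + h) - f u) @[h --> 0^'] --> derive1 f u.
Proof.
rewrite derive1E /derivable; set g := (fun h : R => h^-1 *: _) => cg.
have gE : (fun h => h^-1 * (f (u + h) - f u)) = g.
  by apply/funext => t; rewrite /g /= [t *: 1]mulr1 (addrC u).
by rewrite gE; exact: cg.
Qed.

Lemma derive1_eps f u e : derivable f u 1 -> 0 < e -> exists2 d, 0 < d &
  forall h, `|h| < d -> `|f (u + h) - f u - derive1 f u * h| <= e * `|h|.
Proof.
move=> /derive1_cvg/cvgrPdist_le h e0; have /nbhs_ballP[d /= d0 dP] := h e e0.
exists d => // t td; have [->|t0] := eqVneq t 0.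
  by rewrite addr0 subrr mulr0 subr0 normr0 mulr0.
have := dP t; rewrite /ball/= sub0r normrN => /(_ td t0) h1.
have -> : f (u + t) - f u - derive1 f u * t =
   - ((derive1 f u - t^-1 * (f (u + t) - f u)) * t) by field.
by rewrite normrN normrM ler_wpM2r.
Qed.

(** Compare the difference quotient for a small step towards [v] with the slope
    of the chord. *)
Lemma convex_tangent f u v : convex_ineq (f : R^o -> R) -> derivable f u 1 ->
  f u + derive1 f u * (v - u) <= f v.
Proof.
move=> cf df; apply/ler_addgt0Pr => e e0.
have [->|vu] := eqVneq v u; first by rewrite subrr mulr0 addr0 lerDl ltW.
have nvu : 0 < `|v - u| by rewrite normr_gt0 subr_eq0.
have [d d0 dP] := derive1_eps df (divr_gt0 e0 nvu).
pose t := Num.min 1 (d / 2 / `|v - u|).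
have t0 : 0 < t by rewrite lt_min ltr01 !divr_gt0.
have t1 : t <= 1 by rewrite ge_min lexx.
have td : `|t * (v - u)| < d.
  rewrite normrM gtr0_norm//; apply: (@le_lt_trans _ _ (d / 2)); last lra.
  by rewrite -ler_pdivlMr// ge_min lexx orbT.
have := dP _ td; rewrite ler_norml normrM (gtr0_norm t0) => /andP[h1 _].
have t01 : 0 <= t <= 1 by rewrite ltW.
have := cf t v u t01.
rewrite (_ : t *: v + (1 - t) *: u = u + t * (v - u)); last by rewrite /GRing.scale/=; ring.
move=> h2; rewrite -(ler_pM2l t0).
have h3 : e / `|v - u| * (t * `|v - u|) = t * e by field; rewrite gt_eqF.
move: h1; rewrite h3; lra.
Qed.

Lemma convex_derive1_mono f : convex_ineq (f : R^o -> R) ->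
  (forall u, derivable f u 1) -> forall u v, u <= v -> derive1 f u <= derive1 f v.
Proof.
move=> cf df u v; rewrite le_eqVlt => /predU1P[->//|uv].
have h1 := convex_tangent v cf (df u); have h2 := convex_tangent u cf (df v).
have vu : 0 < v - u by rewrite subr_gt0.
rewrite -(ler_pM2r vu); lra.
Qed.

Section OneLipschitz.
Variable psi : R -> R.
Hypothesis lip : forall x y, `|psi x - psi y| <= `|x - y|.

Lemma derivative_or0_itv u : {homo psi : x y / x <= y} -> 0 <= derivative_or0 psi u <= 1.
Proof.
move=> mono; rewrite /derivative_or0; case: asboolP => [/derive1_cvg dp|_]; last by rewrite lexx ler01.
have q01 h : h != 0 -> 0 <= h^-1 * (psi (u + h) - psi u) <= 1.
  move=> h0; have := lip (u + h) u; rewrite addrAC subrr add0r => l.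
  have [hp|hn|/eqP] := ltgtP h 0; last by rewrite (negPf h0).
    have m : psi (u + h) <= psi u by apply: mono; lra.
    rewrite (ler0_norm (ltW hp)) ler0_norm ?subr_le0// in l.
    have -> : h^-1 * (psi (u + h) - psi u) = (psi u - psi (u + h)) / (- h).
      by field; rewrite h0.
    have hm : 0 < - h by lra.
    by rewrite divr_ge0 ?subr_ge0 ?(ltW hm)//= ler_pdivrMr// mul1r; lra.
  have m : psi u <= psi (u + h) by apply: mono; lra.
  rewrite (gtr0_norm hn) ger0_norm ?subr_ge0// in l.
  by rewrite mulrC divr_ge0 ?subr_ge0 ?(ltW hn)//= ler_pdivrMr// mul1r.
apply/andP; split.
  apply: (cvgr_to_ge dp); near=> h; have h0 : h != 0 by near: h; exact: nbhs_dnbhs_neq.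
  by have /andP[] := q01 h h0.
apply: (cvgr_to_le dp); near=> h; have h0 : h != 0 by near: h; exact: nbhs_dnbhs_neq.
by have /andP[] := q01 h h0.
Unshelve. all: by end_near. Qed.

(** If [r] moves with nonzero speed then the differentiability of [psi \o r]
    forces that of [psi] at [r0]; otherwise both sides vanish, because [psi] is
    Lipschitz. *)
Lemma chain_or0 (r : R -> R) (r0 dr dphi : R) :
  t^-1 * (r t - r0) @[t --> 0^'] --> dr ->
  t^-1 * (psi (r t) - psi r0) @[t --> 0^'] --> dphi ->
  dphi = derivative_or0 psi r0 * dr.
Proof.
move=> cr cphi.
have le : `|dphi| <= `|dr|.
  rewrite -subr_ge0; apply: (cvgr_to_ge (cvgB (cvg_norm cr) (cvg_norm cphi))).
  by apply: nearW => t; rewrite subr_ge0 !normrM ler_wpM2l.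
have [dr0|dr0] := eqVneq dr 0.
  by rewrite dr0 mulr0; apply/eqP; rewrite -normr_le0 (le_trans le)// dr0 normr0.
have ndr : 0 < `|dr| by rewrite normr_gt0.
suff cpsi : s^-1 * (psi (r0 + s) - psi r0) @[s --> 0^'] --> dphi / dr.
  have dpsi : derivable psi r0 1.
    apply/cvg_ex; exists (dphi / dr).
    apply: cvg_trans cpsi; apply: near_eq_cvg; apply: nearW => h /=.
    by rewrite [h *: 1]mulr1 (addrC h).
  rewrite /derivative_or0; case: asboolP => // _.
  have -> : derive1 psi r0 = dphi / dr.
    exact: (cvg_unique _ (derive1_cvg dpsi) cpsi).
  by rewrite divfK.
apply/cvgrPdist_le => e e0.
have e1 : 0 < e / 2 * `|dr| by rewrite mulr_gt0// divr_gt0.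
move/cvgrPdist_le : cr => /(_ _ e1) /nbhs_ballP[d1 /= d10 d1P].
move/cvgrPdist_le : cphi => /(_ _ e1) /nbhs_ballP[d2 /= d20 d2P].
have d0 : 0 < Num.min d1 d2 * `|dr| by rewrite mulr_gt0// lt_min d10.
apply/nbhs_ballP; exists (Num.min d1 d2 * `|dr|) => //= s.
rewrite /ball/= sub0r normrN => sd s0.
pose t := s / dr; have t0 : t != 0 by rewrite mulf_neq0 ?invr_neq0.
have : `|t| < Num.min d1 d2 by rewrite normrM normfV ltr_pdivrMr.
rewrite lt_min => /andP[td1 td2].
have := d1P t; rewrite /ball/= sub0r normrN => /(_ td1 t0) h1.
have := d2P t; rewrite /ball/= sub0r normrN => /(_ td2 t0) h2.
have sE : s = t * dr by rewrite /t divfK.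
have -> : dphi / dr - s^-1 * (psi (r0 + s) - psi r0) =
   (dphi - t^-1 * (psi (r t) - psi r0)) / dr + s^-1 * (psi (r t) - psi (r0 + s)).
  by rewrite sE; field; rewrite dr0 t0.
have h3 : `|s^-1 * (psi (r t) - psi (r0 + s))| <= e / 2.
  rewrite normrM (le_trans (ler_wpM2l (normr_ge0 _) (lip _ _)))//.
  rewrite -normrM (_ : s^-1 * (r t - (r0 + s)) = - ((dr - t^-1 * (r t - r0)) / dr)).
    by rewrite normrN normrM normfV ler_pdivrMr.
  by rewrite sE; field; rewrite dr0 t0.
rewrite (le_trans (ler_normD _ _))// [leRHS]splitr lerD//.
by rewrite normrM normfV ler_pdivrMr.
Qed.

End OneLipschitz.
End ScalarDerivative.

(** * Optimality, monotonicity and Lipschitz bounds for the estimator *)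

Section Estimator.
Context {R : realType} {n p : nat}.
Local Notation E := ('cV[R]_n * 'M[R]_(n, p))%type.
Variables (mu : R) (rho : R -> R) (Sigma : 'M[R]_p) (g : 'cV[R]_p -> R).
Hypotheses (n_gt0 : (0 < n)%N) (mu_gt0 : 0 < mu).
Hypothesis rho_convex : convex_ineq (rho : R^o -> R).
Hypothesis rho_derivable : forall u, derivable rho u 1.
Hypothesis psi_lip : forall u v, `|derive1 rho u - derive1 rho v| <= `|u - v|.
Hypotheses (Sigma_cov : is_covariance Sigma) (Sigma_unit : Sigma \in unitmx).
Hypothesis g_convex : convex_ineq (fun b => g b - mu / 2 * qform Sigma b).

Local Notation psi := (derive1 rho).
Local Notation q := (qform Sigma).

Definition beta (z : E) : 'cV[R]_p := betahat rho g z.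
Definition resid (z : E) (b : 'cV[R]_p) (i : 'I_n) : R := z.1 i 0 - (z.2 *m b) i 0.
Definition score (z : E) (i : 'I_n) : R := psi (resid z (beta z) i).

Let nR0 : 0 < n%:R :> R. Proof. by rewrite ltr0n. Qed.

Lemma beta_argmin z b : objective rho g z.1 z.2 (beta z) <= objective rho g z.1 z.2 b.
Proof.
have [b0 h0] : exists b0, forall b, objective rho g z.1 z.2 b0 <= objective rho g z.1 z.2 b.
  have mu2 : 0 < mu / 2 by rewrite divr_gt0.
  pose h b := n%:R^-1 * (\sum_(i < n) rho (resid z b i)) + (g b - mu / 2 * q b).
  have ch : convex_ineq h.
    apply: convex_ineqD => // t x y t01.
    rewrite mulrCA [X in _ <= _ + X]mulrCA -mulrDr ler_pM2l ?invr_gt0//.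
    rewrite !mulr_sumr -big_split/=; apply: ler_sum => i _.
    have -> : resid z (t *: x + (1 - t) *: y) i = t *: (resid z x i : R^o) + (1 - t) *: (resid z y i : R^o).
      by rewrite /resid mulmxDr -!scalemxAr !mxE /GRing.scale/=; ring.
    exact: rho_convex.
  have [b0 hb0] := strongly_convex_has_min Sigma_cov Sigma_unit mu2 ch.
  by exists b0 => b'; have := hb0 b'; rewrite /h /objective /resid; lra.
have := @xgetPex _ 0 [set b | forall b', objective rho g z.1 z.2 b <= objective rho g z.1 z.2 b'].
by move=> /(_ (ex_intro _ b0 h0)); exact.
Qed.

Lemma rho_le u h : rho (u + h) <= rho u + psi u * h + h ^+ 2.
Proof.
have := convex_tangent u rho_convex (@rho_derivable (u + h)).
have := psi_lip (u + h) u; rewrite addrAC subrr add0r => l.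
have : (psi (u + h) - psi u) * h <= h ^+ 2.
  rewrite -[h ^+ 2]real_normK ?num_real// expr2 (le_trans (ler_norm _))// normrM.
  by rewrite ler_wpM2r.
lra.
Qed.

(** First-order optimality: the loss is differentiable and [g] is strongly
    convex, so the comparison with [beta + t (b - beta)] divided by [t] gives,
    as [t] tends to 0, a subgradient inequality with a quadratic gain. *)
Lemma beta_first_order z b :
  n%:R^-1 * (\sum_i score z i * (z.2 *m (b - beta z)) i 0) + mu / 2 * q (b - beta z)
    <= g b - g (beta z).
Proof.
set d := b - beta z; set u := fun i => (z.2 *m d) i 0.
set G := g b - g (beta z); set S := \sum_i _.
pose C := n%:R^-1 * (\sum_i u i ^+ 2) + mu / 2 * q d.
have C0 : 0 <= C.
  rewrite addr_ge0 ?mulr_ge0 ?invr_ge0 ?(ltW nR0) ?sumr_ge0//; first by move=> i _; exact: sqr_ge0.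
    by rewrite (ltW mu_gt0).
  exact: qform_ge0.
have key (t : R) : 0 < t -> t <= 1 -> n%:R^-1 * S + mu / 2 * q d <= G + t * C.
  move=> t0 t1; have t01 : 0 <= t <= 1 by rewrite ltW.
  have := beta_argmin z (t *: b + (1 - t) *: beta z).
  rewrite /objective => h1.
  have h2 := g_convex b (beta z) t01.
  rewrite qform_conv ?Sigma_cov.1// -/d in h2.
  have h3 : \sum_(i < n) rho (z.1 i 0 - (z.2 *m (t *: b + (1 - t) *: beta z)) i 0) <=
      \sum_(i < n) rho (z.1 i 0 - (z.2 *m beta z) i 0) - t * S + t ^+ 2 * \sum_i u i ^+ 2.
    rewrite /S !mulr_sumr -sumrB -big_split/=; apply: ler_sum => i _.
    have -> : z.1 i 0 - (z.2 *m (t *: b + (1 - t) *: beta z)) i 0 = resid z (beta z) i + - (t * u i).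
      rewrite /u /d /resid mulmxDr mulmxBr -!scalemxAr; rewrite !mxE; ring.
    have := rho_le (resid z (beta z) i) (- (t * u i)); rewrite -/(score z i) /resid.
    rewrite /u; lra.
  have iN0 : 0 <= n%:R^-1 :> R by rewrite invr_ge0 ltW.
  have h4 := ler_wpM2l iN0 h3; clear h3.
  rewrite -(ler_pM2l t0) /C.
  move: (n%:R^-1) (\sum_i u i ^+ 2) h1 h2 h4 => iN U; rewrite /G.
  move: (\sum_(i < n) _) (\sum_(i < n) _) S (q _) (q _) (q _) (g _) (g _) (g _).
  move=> b1 b0 S' qd qb0 qb gb g1 g0 h1 h2 h4; rewrite -subr_ge0.
  have h5 := lerD h1 (lerD h2 h4); rewrite -subr_ge0 in h5.
  by apply: le_trans h5 _; rewrite le_eqVlt; apply/orP; left; apply/eqP; field.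
apply/ler_addgt0Pr => e e0; have C1 : 0 < C + 1 by rewrite ltr_wpDl.
pose t := Num.min 1 (e / (C + 1)).
have t0 : 0 < t by rewrite lt_min ltr01 divr_gt0.
have t1 : t <= 1 by rewrite ge_min lexx.
apply: (le_trans (key t t0 t1)); rewrite lerD2l.
have : t <= e / (C + 1) by rewrite ge_min lexx orbT.
rewrite ler_pdivlMr// => h; apply: le_trans h.
by rewrite ler_pM2l// lerDl.
Qed.

Lemma psi_mono : {homo psi : u v / u <= v}.
Proof. exact: convex_derive1_mono. Qed.

(** Adding the optimality inequalities of two samples eliminates [g]. *)
Lemma beta_monotone z z' : n%:R * mu * q (beta z' - beta z) <=
  \sum_i (score z' i * (z'.2 *m (beta z' - beta z)) i 0 -
          score z i * (z.2 *m (beta z' - beta z)) i 0).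
Proof.
set d := beta z' - beta z; have h1 := beta_first_order z (beta z'); have h2 := beta_first_order z' (beta z).
have dE : beta z - beta z' = (-1) *: d by rewrite scaleN1r opprB.
rewrite dE qformZ sqrrN expr1n mul1r in h2.
have h3 : \sum_i score z' i * (z'.2 *m ((-1) *: d)) i 0 = - \sum_i score z' i * (z'.2 *m d) i 0.
  by rewrite -sumrN; apply: eq_bigr => i _; rewrite -scalemxAr mxE mulN1r mulrN.
rewrite h3 in h2; rewrite sumrB -/d in h1 *.
move: h1 h2; set S1 := \sum_i _; set S2 := \sum_i _ => h1 h2.
have : n%:R^-1 * (n%:R * mu * q d) <= n%:R^-1 * (S2 - S1).
  by rewrite !mulrA mulVf ?gt_eqF// mul1r; lra.
by rewrite ler_pM2l// invr_gt0.
Qed.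

Lemma mulmx_entry_le (X : 'M[R]_(n, p)) (v : 'cV[R]_p) i :
  `|(X *m v) i 0| <= p%:R * `|X| * `|v|.
Proof.
rewrite mxE (le_trans (ler_norm_sum _ _ _))//.
apply: (@le_trans _ _ (\sum_(j < p) `|X| * `|v|)).
  apply: ler_sum => j _; rewrite normrM ler_pM// ?col_norm//.
  by rewrite [leRHS]/Num.norm/= mx_normrE (le_bigmax _ _ (i, j)).
by rewrite sumr_const card_ord -(mulr_natl (_ * _)) mulrA.
Qed.

Lemma norm_fst (z : E) : `|z.1| <= `|z|.
Proof. by rewrite prod_normE le_max lexx. Qed.

Lemma norm_snd (z : E) : `|z.2| <= `|z|.
Proof. by rewrite prod_normE le_max lexx orbT. Qed.

Lemma resid_lip z z' b i : `|resid z' b i - resid z b i| <= (1 + p%:R * `|b|) * `|z' - z|.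
Proof.
have -> : resid z' b i - resid z b i = (z' - z).1 i 0 - ((z' - z).2 *m b) i 0.
  by rewrite /resid mulmxBl !mxE; ring.
rewrite (le_trans (ler_normB _ _))// mulrDl mul1r lerD//.
  by rewrite (le_trans (col_norm _ _))// norm_fst.
apply: (le_trans (mulmx_entry_le _ _ _)); rewrite mulrAC ler_wpM2l ?mulr_ge0//.
exact: norm_snd.
Qed.

(** The part of the score difference that is due to the change of the estimator
    has a favourable sign, by monotonicity of [psi].  What remains compares the
    two samples at the same coefficients, with a bound linear in [z' - z]. *)
Lemma beta_lip : exists2 C, 0 < C & forall z z',
  `|beta z' - beta z| <= C * ((1 + p%:R * `|beta z|) * (`|z'| + `|z|) + `|psi 0|) * `|z' - z|.
Proof.
have [C C0 hC] := norm_le_qform Sigma_cov Sigma_unit.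
exists (C / mu * (p%:R + 1)) => [|z z']; first by rewrite mulr_gt0 ?divr_gt0 ?ltr_wpDl.
set d := beta z' - beta z; set A := (_ * _ + _).
have A0 : 0 <= A by rewrite addr_ge0// mulr_ge0 ?addr_ge0 ?mulr_ge0.
have [->|dn0] := eqVneq d 0; first by rewrite normr0 mulr_ge0// mulr_ge0// ltW// mulr_gt0 ?divr_gt0 ?ltr_wpDl.
have nd : 0 < `|d| by rewrite normr_gt0.
have h1 := beta_monotone z z'; rewrite /= -/d in h1.
have term i : score z' i * (z'.2 *m d) i 0 - score z i * (z.2 *m d) i 0 <=
    p%:R * A * `|z' - z| * `|d|.
  have mono : (score z' i - psi (resid z' (beta z) i)) * (z'.2 *m d) i 0 <= 0.
    have rE : resid z' (beta z') i = resid z' (beta z) i - (z'.2 *m d) i 0.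
      by rewrite /resid /d mulmxBr !mxE; ring.
    rewrite /score rE; move: ((z'.2 *m d) i 0) => x; have [x0|/ltW x0] := leP 0 x.
      by rewrite mulr_le0_ge0// subr_le0 psi_mono// gerBl.
    by rewrite mulr_ge0_le0// subr_ge0 psi_mono// lerBrDl gerDr.
  have e1 : (psi (resid z' (beta z) i) - score z i) * (z'.2 *m d) i 0 <=
      ((1 + p%:R * `|beta z|) * `|z' - z|) * (p%:R * `|z'| * `|d|).
    rewrite (le_trans (ler_norm _))// normrM ler_pM//.
      by rewrite (le_trans (psi_lip _ _))// resid_lip.
    by rewrite (le_trans (mulmx_entry_le _ _ _))// ler_wpM2r// ler_wpM2l// norm_snd.
  have e2 : score z i * ((z' - z).2 *m d) i 0 <=
      (`|psi 0| + (1 + p%:R * `|beta z|) * `|z|) * (p%:R * `|z' - z| * `|d|).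
    rewrite (le_trans (ler_norm _))// normrM ler_pM//.
      have -> : score z i = psi 0 + (score z i - psi 0) by ring.
      rewrite (le_trans (ler_normD _ _))// lerD2l (le_trans (psi_lip _ _))// subr0.
      have := resid_lip 0 z (beta z) i; rewrite subr0.
      by rewrite [X in _ - X](_ : _ = 0) ?subr0// /resid mul0mx !mxE subrr.
    by rewrite (le_trans (mulmx_entry_le _ _ _))// ler_wpM2r// ler_wpM2l// norm_snd.
  have -> : score z' i * (z'.2 *m d) i 0 - score z i * (z.2 *m d) i 0 =
     (score z' i - psi (resid z' (beta z) i)) * (z'.2 *m d) i 0 +
     (psi (resid z' (beta z) i) - score z i) * (z'.2 *m d) i 0 +
     score z i * ((z' - z).2 *m d) i 0.
    by rewrite [(z' - z).2]/= mulmxBl !mxE; ring.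
  rewrite /A; lra.
have h2 : n%:R * mu * q d <= n%:R * (p%:R * A * `|z' - z| * `|d|).
  apply: (le_trans h1); apply: (le_trans (ler_sum _ (fun i _ => term i))).
  by rewrite sumr_const card_ord -(mulr_natl (_ * _)).
rewrite -mulrA ler_pM2l// in h2.
have h3 := hC d.
have h4 : mu * `|d| * `|d| <= C * (p%:R * A * `|z' - z|) * `|d|.
  apply: (@le_trans _ _ (C * (mu * q d))).
    by rewrite mulrCA -mulrA ler_pM2l// -expr2.
  by rewrite -[leRHS]mulrA ler_pM2l.
rewrite ler_pM2r// in h4.
rewrite -(ler_pM2l mu_gt0); apply: (le_trans h4).
have -> : mu * (C / mu * (p%:R + 1) * A * `|z' - z|) = C * (p%:R + 1) * A * `|z' - z|.
  by field; rewrite gt_eqF.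
rewrite !mulrA; apply: ler_wpM2r => //; apply: ler_wpM2r => //.
by rewrite ler_pM2l// lerDl.
Qed.

End Estimator.

(** * The derivative of the estimator along a direction *)

Lemma cvg_sum_fin {R : realType} {T : Type} {I : finType} (F : set_system T)
    {FF : Filter F} (f : I -> T -> R) (l : I -> R) :
  (forall i, f i t @[t --> F] --> l i) -> \sum_i f i t @[t --> F] --> \sum_i l i.
Proof.
move=> fl; elim: (index_enum I) => [|i s IH].
  by rewrite big_nil; under eq_fun do rewrite big_nil; exact: cvg_cst.
by rewrite big_cons; under eq_fun do rewrite big_cons; apply: cvgD; [exact: fl|exact: IH].
Qed.

Lemma directional_cvg {R : realType} {V W : normedModType R} (f : V -> W) (z v : V) :
  differentiable f z -> t^-1 *: (f (z + t *: v) - f z) @[t --> 0^'] --> 'd f z v.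
Proof.
move=> df; rewrite -deriveE//.
have /cvg_ex[l hl] : derivable f z v by exact: diff_derivable.
have -> : (fun t : R => t^-1 *: (f (z + t *: v) - f z)) =
    (fun t : R => t^-1 *: ((f \o shift z) (t *: v) - f z)).
  by apply/funext => t; rewrite /= (addrC z).
rewrite /derive (cvg_lim _ hl)//; exact: norm_hausdorff.
Qed.

Lemma differentiable_entries {R : realType} {V : normedModType R} {p : nat}
    (f : V -> 'cV[R]_p) z :
  (forall j, differentiable (fun w => f w j 0) z) -> differentiable f z.
Proof.
move=> df; have -> : f = \sum_(j < p) (fun w => f w j 0 *: (delta_mx j 0 : 'cV[R]_p)).
  apply/funext => w; rewrite fct_sumE [LHS]col_sum_delta//.
apply: differentiable_sum => j; exact: differentiableZl.
Qed.

Section EstimatorDerivative.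
Context {R : realType} {n p : nat}.
Local Notation E := ('cV[R]_n * 'M[R]_(n, p))%type.
Variables (mu : R) (rho : R -> R) (Sigma : 'M[R]_p) (g : 'cV[R]_p -> R).
Hypotheses (n_gt0 : (0 < n)%N) (mu_gt0 : 0 < mu).
Hypothesis rho_convex : convex_ineq (rho : R^o -> R).
Hypothesis rho_derivable : forall u, derivable rho u 1.
Hypothesis psi_lip : forall u v, `|derive1 rho u - derive1 rho v| <= `|u - v|.
Hypotheses (Sigma_cov : is_covariance Sigma) (Sigma_unit : Sigma \in unitmx).
Hypothesis g_convex : convex_ineq (fun b => g b - mu / 2 * qform Sigma b).

Local Notation psi := (derive1 rho).
Local Notation q := (qform Sigma).
Local Notation beta := (@beta R n p rho g).
Local Notation score := (@score R n p rho g).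
Local Notation d z i := (derivative_or0 psi (resid z (beta z) i)).

Lemma beta_lip_ball : exists K : R -> R, forall M (z w : E), `|z| <= M -> `|w| <= M ->
  `|beta z - beta w| <= K M * `|z - w| /\
  forall i, `|score z i - score w i| <= K M * `|z - w|.
Proof.
have [C C0 lipC] := beta_lip n_gt0 mu_gt0 rho_convex rho_derivable psi_lip
  Sigma_cov Sigma_unit g_convex.
pose Bd M := `|beta 0| + C * ((1 + p%:R * `|beta 0|) * M + `|psi 0|) * M.
pose K0 M := C * ((1 + p%:R * Bd M) * (M + M) + `|psi 0|).
pose K1 M := (1 + p%:R * Bd M) + p%:R * M * K0 M.
exists (fun M => K0 M + K1 M) => M z w zM wM.
have M0 : 0 <= M by apply: le_trans zM.
have bd x : `|x| <= M -> `|beta x| <= Bd M.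
  move=> xM; have := lipC 0 x; rewrite normr0 addr0 subr0 => h.
  have -> : beta x = beta 0 + (beta x - beta 0) by rewrite addrC subrK.
  rewrite (le_trans (ler_normD _ _))// lerD2l (le_trans h)//.
  have pb : 0 <= 1 + p%:R * `|beta 0| by rewrite addr_ge0// mulr_ge0.
  apply: ler_pM => //.
    by rewrite mulr_ge0 ?(ltW C0)// addr_ge0// mulr_ge0.
  by rewrite ler_wpM2l ?(ltW C0)// lerD2r ler_wpM2l.
have Bd0 : 0 <= Bd M by apply: le_trans (bd z zM).
have K00 : 0 <= K0 M by rewrite mulr_ge0 ?(ltW C0)// addr_ge0// mulr_ge0 ?addr_ge0// mulr_ge0.
have K10 : 0 <= K1 M.
  by apply: addr_ge0; [apply: addr_ge0 => //; exact: mulr_ge0|apply: mulr_ge0 => //; exact: mulr_ge0].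
have hb : `|beta z - beta w| <= K0 M * `|z - w|.
  apply: (le_trans (lipC w z)); apply: ler_wpM2r => //.
  apply: ler_wpM2l; first exact: ltW.
  rewrite lerD2r; apply: ler_pM => //.
    by rewrite lerD2l ler_wpM2l// bd.
  exact: lerD.
split.
  by apply: (le_trans hb); rewrite ler_wpM2r// lerDl.
move=> i; apply: (@le_trans _ _ (K1 M * `|z - w|)); last by rewrite ler_wpM2r// lerDr.
rewrite /score (le_trans (psi_lip _ _))//.
have -> : resid z (beta z) i - resid w (beta w) i = (resid z (beta z) i - resid w (beta z) i)
   - (w.2 *m (beta z - beta w)) i 0.
  by rewrite /resid mulmxBr !mxE; ring.
rewrite (le_trans (ler_normB _ _))// /K1 mulrDl lerD//.
  by rewrite (le_trans (resid_lip _ _ _ _))// ler_wpM2r// lerD2l ler_wpM2l// bd.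
rewrite (le_trans (mulmx_entry_le _ _ _))// -!mulrA ler_wpM2l//.
apply: ler_pM => //; first by apply: le_trans wM; exact: norm_snd.
by rewrite mulrA.
Qed.

Section Direction.
Variables (z zeta : E).
Hypothesis beta_diff : differentiable beta z.
Hypothesis score_diff : forall i, differentiable (fun w => score w i) z.

Local Notation b' := ('d beta z zeta).

Definition dresid i := zeta.1 i 0 - (zeta.2 *m beta z) i 0 - (z.2 *m b') i 0.

Let quot t := t^-1 *: (beta (z + t *: zeta) - beta z).

Let quot_cvg : quot t @[t --> 0^'] --> b'.
Proof. exact: directional_cvg. Qed.

Let entry_cvg (T : Type) (F : set_system T) (FF : Filter F) (f : T -> 'cV[R]_p) (l : 'cV[R]_p) j :
  f @ F --> l -> f t j 0 @[t --> F] --> l j 0.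
Proof.
move=> fl; apply: (@cvg_comp _ _ _ f (fun v : 'cV[R]_p => v j 0) F (nbhs l)) => //.
exact: (@coord_continuous R p 1 j 0).
Qed.

Let mulmx_cvg (T : Type) (F : set_system T) (FF : Filter F) (f : T -> 'cV[R]_p) (l : 'cV[R]_p) (X : 'M[R]_(n, p)) i :
  f @ F --> l -> (X *m f t) i 0 @[t --> F] --> (X *m l) i 0.
Proof.
move=> fl; rewrite mxE; under eq_fun do rewrite mxE.
apply: cvg_sum_fin => j; apply: cvgM; first exact: cvg_cst.
exact: entry_cvg.
Qed.

Let shift_cvg : z + t *: zeta @[t --> 0^'] --> z.
Proof.
rewrite -[X in _ --> X]addr0 -(scale0r zeta).
apply: cvgD; first exact: cvg_cst.
by apply: cvgZr_tmp; exact: nbhs_dnbhs.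
Qed.

Let beta_cvg : beta (z + t *: zeta) @[t --> 0^'] --> beta z.
Proof.
apply: (cvg_comp _ _ shift_cvg); exact: differentiable_continuous.
Qed.

Let resid_cvg i : t^-1 * (resid (z + t *: zeta) (beta (z + t *: zeta)) i - resid z (beta z) i)
  @[t --> 0^'] --> dresid i.
Proof.
have h : zeta.1 i 0 - (zeta.2 *m beta (z + t *: zeta)) i 0 - (z.2 *m quot t) i 0
    @[t --> 0^'] --> dresid i.
  apply: cvgB; last exact: mulmx_cvg.
  by apply: cvgB; [exact: cvg_cst|exact: mulmx_cvg].
apply: cvg_trans h; apply: near_eq_cvg; near=> t.
have t0 : t != 0 by near: t; exact: nbhs_dnbhs_neq.
rewrite /resid /quot /= !mulmxDl -!scalemxAl -scalemxAr mulmxBr !mxE.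
by field.
Unshelve. all: by end_near. Qed.

(** The score is only known to be differentiable as a function of the data,
    which is enough for [chain_or0]. *)
Lemma dscoreE i : 'd (fun w => score w i) z zeta = d z i * dresid i.
Proof.
apply: (@chain_or0 _ psi psi_lip (fun t => resid (z + t *: zeta) (beta (z + t *: zeta)) i)
  _ _ _ (@resid_cvg i)).
exact: (@directional_cvg _ _ _ (fun w => score w i) z zeta (score_diff i)).
Qed.

(** The limit of [beta_monotone], divided by the square of the step. *)
Lemma dbeta_monotone : n%:R * mu * q b' <=
  \sum_i (d z i * dresid i * (z.2 *m b') i 0 + score z i * (zeta.2 *m b') i 0).
Proof.
pose L t := n%:R * mu * q (quot t).
pose U t := \sum_i (t^-1 * (score (z + t *: zeta) i - score z i) * (z.2 *m quot t) i 0 +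
   score (z + t *: zeta) i * (zeta.2 *m quot t) i 0).
have cL : L t @[t --> 0^'] --> n%:R * mu * q b'.
  apply: cvgM; first exact: cvg_cst.
  rewrite /qform bformE; under eq_fun do rewrite bformE.
  apply: cvg_sum_fin => j; apply: cvgM; first exact: entry_cvg.
  rewrite mxE; under eq_fun do rewrite mxE.
  apply: cvg_sum_fin => k; apply: cvgM; first exact: cvg_cst.
  exact: entry_cvg.
have cU : U t @[t --> 0^'] --> \sum_i (d z i * dresid i * (z.2 *m b') i 0 + score z i * (zeta.2 *m b') i 0).
  apply: cvg_sum_fin => i; apply: cvgD; apply: cvgM.
  - rewrite -dscoreE.
    exact: (@directional_cvg _ _ _ (fun w => score w i) z zeta (score_diff i)).
  - exact: mulmx_cvg.
  - apply: (@cvg_comp _ _ _ (fun t : R => z + t *: zeta) (fun w => score w i) _ (nbhs z)).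
      exact: shift_cvg.
    exact: (differentiable_continuous (@score_diff i)).
  - exact: mulmx_cvg.
rewrite -subr_ge0; apply: (cvgr_to_ge (cvgB cU cL)); near=> t.
have t0 : t != 0 by near: t; exact: nbhs_dnbhs_neq.
rewrite subr_ge0 /L /U.
have h := beta_monotone n_gt0 mu_gt0 rho_convex rho_derivable psi_lip
  Sigma_cov Sigma_unit g_convex z (z + t *: zeta).
have t2 : 0 <= (t^-1) ^+ 2 by rewrite sqr_ge0.
have := ler_wpM2l t2 h.
have -> : (t^-1) ^+ 2 * (n%:R * mu * q (beta (z + t *: zeta) - beta z)) = n%:R * mu * q (quot t).
  by rewrite /quot qformZ; ring.
move=> /le_trans; apply; rewrite mulr_sumr le_eqVlt; apply/orP; left; apply/eqP.
apply: eq_bigr => i _; rewrite /quot /= mulmxDl -!scalemxAl -!scalemxAr !mxE.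
by field.
Unshelve. all: by end_near. Qed.

End Direction.
End EstimatorDerivative.

(** * The sensitivity matrix *)

Lemma linear_col_matrix {R : realType} {N p : nat} (L : 'cV[R]_N -> 'cV[R]_p) :
  linear L -> exists M : 'M[R]_(p, N), forall c, L c = M *m c.
Proof.
move=> linL; pose L' : {linear 'cV[R]_N -> 'cV[R]_p} :=
  HB.pack L (GRing.isLinear.Build R _ _ *:%R L linL).
exists (\matrix_(j, k) L (delta_mx k 0) j 0) => c.
rewrite {1}[c]col_sum_delta -[L]/(L' : _ -> _) linear_sum.
apply/matrixP => j o; rewrite ord1 summxE mxE; apply: eq_bigr => k _.
by rewrite linearZ !mxE mulrC.
Qed.

Lemma dot_trmx {R : realType} {n p : nat} (M : 'M[R]_(n, p)) (b : 'cV[R]_p) (a : 'I_n -> R) :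
  (b^T *m (M^T *m (\col_i a i))) 0 0 = \sum_i a i * (M *m b) i 0.
Proof.
rewrite mulmxA -trmx_mul mxE; apply: eq_bigr => i _.
by rewrite [(M *m b)^T _ _]mxE [(\col_ _ _) _ _]mxE mulrC.
Qed.

Section Sensitivity.
Context {R : realType} {n p : nat}.
Local Notation E := ('cV[R]_n.+1 * 'M[R]_(n.+1, p))%type.
Local Notation I := ('I_n.+1 + 'I_n.+1 * 'I_p)%type.
Variables (mu : R) (rho : R -> R) (Sigma : 'M[R]_p) (g : 'cV[R]_p -> R).
Hypotheses (mu_gt0 : 0 < mu).
Hypothesis rho_convex : convex_ineq (rho : R^o -> R).
Hypothesis rho_derivable : forall u, derivable rho u 1.
Hypothesis psi_lip : forall u v, `|derive1 rho u - derive1 rho v| <= `|u - v|.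
Hypotheses (Sigma_cov : is_covariance Sigma) (Sigma_unit : Sigma \in unitmx).
Hypothesis g_convex : convex_ineq (fun b => g b - mu / 2 * qform Sigma b).

Local Notation psi := (derive1 rho).
Local Notation q := (qform Sigma).
Local Notation beta := (@beta R n.+1 p rho g).
Local Notation score := (@score R n.+1 p rho g).
Local Notation d z i := (derivative_or0 psi (resid z (beta z) i)).

Variable z : E.
Hypothesis beta_diff : differentiable beta z.
Hypothesis score_diff : forall i, differentiable (fun w => score w i) z.

(** The derivative of [X^T psi (r)] along [zeta] with the coefficients held at
    [beta z]; the derivative of the estimator depends on [zeta] only through
    this vector. *)
Definition forcing (zeta : E) : 'cV[R]_p :=
  z.2^T *m (\col_i (d z i * (zeta.1 i 0 - (zeta.2 *m beta z) i 0))) +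
  zeta.2^T *m (\col_i score z i).

(** [dbeta_monotone] with the terms quadratic in [X b'] moved to the left. *)
Lemma dbeta_energy zeta : n.+1%:R * mu * q ('d beta z zeta) +
    \sum_i d z i * (z.2 *m 'd beta z zeta) i 0 ^+ 2
  <= (('d beta z zeta)^T *m forcing zeta) 0 0.
Proof.
have := dbeta_monotone (ltn0Sn n) mu_gt0 rho_convex rho_derivable psi_lip
  Sigma_cov Sigma_unit g_convex zeta beta_diff score_diff.
rewrite /forcing mulmxDr mxE !dot_trmx -big_split/= => h.
rewrite -lerBrDr -sumrB; apply: (le_trans h); rewrite le_eqVlt; apply/orP; left; apply/eqP.
by apply: eq_bigr => i _; rewrite /dresid; ring.
Qed.

Lemma weight_itv i : 0 <= d z i <= 1.
Proof. apply: derivative_or0_itv => //; exact: convex_derive1_mono. Qed.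

(** Both the derivative and the forcing are linear in the direction, and the
    energy inequality compares the two matrices that represent them. *)
Lemma exists_sensitivity : exists A : 'M[R]_p,
  opnorm (psd_sqrt Sigma *m A *m psd_sqrt Sigma) <= (n.+1%:R * mu)^-1 /\
  forall zeta, 'd beta z zeta = A *m forcing zeta.
Proof.
pose dir (c : 'cV[R]_#|{: I}|) : E := of_entry (fun k => c (enum_rank k) 0).
have dirD a u v : dir (a *: u + v) = a *: dir u + dir v.
  by apply: entryP => k; rewrite entryD entryZ !of_entryK !mxE.
have [B BE] : exists B : 'M[R]_(p, #|{: I}|), forall c, 'd beta z (dir c) = B *m c.
  by apply: linear_col_matrix => a u v; rewrite dirD linearD linearZ.
have [Q QE] : exists Q : 'M[R]_(p, #|{: I}|), forall c, forcing (dir c) = Q *m c.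
  apply: linear_col_matrix => a u v; rewrite dirD /forcing /=.
  have -> : (\col_i (d z i * ((a *: (dir u).1 + (dir v).1) i 0 - ((a *: (dir u).2 + (dir v).2) *m beta z) i 0))) =
     a *: (\col_i (d z i * ((dir u).1 i 0 - ((dir u).2 *m beta z) i 0))) +
     \col_i (d z i * ((dir v).1 i 0 - ((dir v).2 *m beta z) i 0)) :> 'cV[R]_n.+1.
    by apply/matrixP => i j; rewrite mulmxDl -scalemxAl !mxE; ring.
  have trD : (a *: (dir u).2 + (dir v).2)^T = a *: (dir u).2^T + (dir v).2^T.
    by rewrite linearD linearZ.
  by rewrite mulmxDr -scalemxAr trD mulmxDl -scalemxAl scalerDr addrACA.
have kappa0 : 0 < n.+1%:R * mu by rewrite mulr_gt0.
have mono c : n.+1%:R * mu * q (B *m c) <= ((B *m c)^T *m (Q *m c)) 0 0.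
  rewrite -BE -QE; apply: le_trans (dbeta_energy (dir c)); rewrite lerDl sumr_ge0// => i _.
  by rewrite mulr_ge0 ?sqr_ge0//; have /andP[] := weight_itv i.
have [A [AQ An]] := weighted_factor_opnorm Sigma_cov Sigma_unit kappa0 mono.
exists A; split => // zeta; pose c : 'cV[R]_#|{: I}| := \col_k entry zeta (enum_val k).
have -> : zeta = dir c by apply: entryP => k; rewrite of_entryK mxE enum_rankK.
by rewrite BE QE mulmxA AQ.
Qed.

Lemma forcing_y i : forcing (delta_mx i 0, 0) = d z i *: (z.2^T *m delta_mx i 0).
Proof.
rewrite /forcing /= [X in _ + X](_ : _ = 0) ?addr0; last by rewrite trmx0 mul0mx.
rewrite scalemxAr; congr (_ *m _).
apply/matrixP => k o; rewrite mul0mx !mxE subr0 ord1 eqxx andbT.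
have [->|_] := eqVneq k i; first by move: (d z i) => x; rewrite !mulr1.
by move: (d z k) (d z i) => x x'; rewrite !mulr0.
Qed.

Lemma forcing_x i j : forcing (0, delta_mx i j) =
  score z i *: delta_mx j 0 - (d z i * beta z j 0) *: (z.2^T *m delta_mx i 0).
Proof.
rewrite /forcing /= [RHS]addrC; congr (_ + _).
  rewrite -scaleNr scalemxAr; congr (_ *m _); apply/matrixP => k o.
  rewrite ord1 !mxE sub0r (bigD1 j)//= big1 ?addr0 => [|l lj]; last first.
    by rewrite mxE (negPf lj) andbF mul0r.
  rewrite mxE eqxx andbT; have [->|_] := eqVneq k i.
    by move: (d z i) => x; rewrite mul1r mulr1 mulrN.
  by move: (d z k) (d z i) => x x'; rewrite mul0r oppr0 !mulr0.
apply/matrixP => k o; rewrite ord1 !mxE (bigD1 i)//= big1 ?addr0 => [|l li]; last first.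
  by rewrite !mxE (negPf li) mul0r.
by rewrite !mxE !eqxx andbT /=; case: eqP => _; rewrite ?mul1r ?mulr1 ?mul0r ?mulr0.
Qed.

(** In the direction of [y_i] the energy inequality reads [d_i a^2 <= d_i a] for
    the entry [a]; if [d_i = 0] then the direction has no forcing and [a = 0]. *)
Lemma leverage_itv i : 0 <= (z.2 *m 'd beta z (delta_mx i 0, 0)) i 0 <= 1.
Proof.
have [A [_ AE]] := exists_sensitivity.
have := dbeta_energy (delta_mx i 0, 0); set b' := 'd beta z _.
have -> : (b'^T *m forcing (delta_mx i 0, 0)) 0 0 = d z i * (z.2 *m b') i 0.
  rewrite /forcing /= [X in _ + X](_ : _ = 0) ?addr0; last by rewrite trmx0 mul0mx.
  rewrite dot_trmx (bigD1 i)//= big1 ?addr0.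
    by rewrite mul0mx !mxE !eqxx subr0 mulr1.
  by move=> k ki; rewrite mul0mx !mxE (negPf ki) subr0 mulr0 mul0r.
have [d0 _] := andP (weight_itv i).
have [di0 _|di0] := eqVneq (d z i) 0.
  have -> : b' = 0 by rewrite /b' AE forcing_y di0 scale0r mulmx0.
  by rewrite mulmx0 mxE lexx ler01.
have dp : 0 < d z i by rewrite lt_neqAle eq_sym di0.
rewrite (bigD1 i)//= => h.
have h1 : 0 <= n.+1%:R * mu * q b' by rewrite mulr_ge0 ?qform_ge0// mulr_ge0// ltW.
have h2 : 0 <= \sum_(k < n.+1 | k != i) d z k * (z.2 *m b') k 0 ^+ 2.
  apply: sumr_ge0 => k _; apply: mulr_ge0; last exact: sqr_ge0.
  by have /andP[] := weight_itv k.
have : d z i * (z.2 *m b') i 0 ^+ 2 <= d z i * (z.2 *m b') i 0 by lra.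
rewrite ler_pM2l// => h3; move: ((z.2 *m b') i 0) h3 => a h3; nra.
Qed.

End Sensitivity.

(** * Gradient formulas almost everywhere *)

(** Evaluate [exists_sensitivity] along the coordinate directions; the two
    traces are sums of [a_i] and of [d_i (1 - a_i)], with the weights [d_i] and
    the diagonal entries [a_i] of [X J] all in [0, 1]. *)
Lemma sensitivity_formulas {R : realType} {n p : nat} (mu : R) (rho : R -> R)
  (Sigma : 'M[R]_p) (g : 'cV[R]_p -> R) (z : 'cV[R]_n.+1 * 'M[R]_(n.+1, p)) :
  0 < mu -> convex_ineq (rho : R^o -> R) -> (forall u, derivable rho u 1) ->
  (forall u v, `|derive1 rho u - derive1 rho v| <= `|u - v|) ->
  is_covariance Sigma -> Sigma \in unitmx ->
  convex_ineq (fun b => g b - mu / 2 * qform Sigma b) ->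
  differentiable (betahat rho g) z ->
  (forall i, differentiable (fun w => score rho g w i) z) ->
  exists A : 'M[R]_p,
      let X := z.2 in
      let psi := derive1 rho in
      let b := betahat rho g z in
      let r := z.1 - X *m b in
      let D := diag_of (map_mx (derivative_or0 psi) r) in
      let J := jacobian_y (betahat rho g) z in
      let df := \tr (X *m J) in
      let V := D *m (1%:M - X *m J) in
      [/\ opnorm (psd_sqrt Sigma *m A *m psd_sqrt Sigma) <= (n.+1%:R * mu)^-1,
          forall i : 'I_n.+1,
            partial_y (betahat rho g) i z =
              derivative_or0 psi (r i 0) *: (A *m X^T *m delta_mx i 0),
          forall (i : 'I_n.+1) (j : 'I_p),
            partial_x (betahat rho g) i j z =
              psi (r i 0) *: (A *m delta_mx j 0)
              - (derivative_or0 psi (r i 0) * b j 0) *: (A *m X^T *m delta_mx i 0),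
          df = \tr (X *m A *m X^T *m D) /\
          V = D - D *m X *m A *m X^T *m D &
          0 <= df <= n.+1%:R /\ 0 <= \tr V <= n.+1%:R].
Proof.
move=> mu0 cr dr lip cS uS cg bd sd.
have [A [An AE]] := exists_sensitivity mu0 cr dr lip cS uS cg bd sd.
exists A => X psi b r D J df V.
have rE i : r i 0 = resid z (beta rho g z) i by rewrite /r /resid !mxE.
pose dd i := derivative_or0 psi (r i 0).
have dd01 i : 0 <= dd i <= 1 by rewrite /dd rE; exact: weight_itv.
have py i : partial_y (betahat rho g) i z = dd i *: (A *m X^T *m delta_mx i 0).
  rewrite /partial_y deriveE// AE forcing_y /dd rE.
  by rewrite -scalemxAr mulmxA.
have px i j : partial_x (betahat rho g) i j z = psi (r i 0) *: (A *m delta_mx j 0)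
    - (dd i * b j 0) *: (A *m X^T *m delta_mx i 0).
  rewrite /partial_x deriveE// AE forcing_x /dd rE mulmxBr -!scalemxAr.
  by rewrite mulmxA.
have DE : D = diag_mx (\row_i dd i).
  rewrite /D /diag_of; congr diag_mx; apply/matrixP => i j.
  by rewrite ord1 [LHS]mxE [LHS]mxE [RHS]mxE.
have JE : J = A *m X^T *m D.
  apply/matrixP => j i; rewrite DE mul_mx_diag [LHS]mxE [RHS]mxE py [LHS]mxE.
  by rewrite -colE [col _ _ _ _]mxE [(\row_ _ _) _ _]mxE mulrC.
have lev i : 0 <= (X *m J) i i <= 1.
  have := leverage_itv mu0 cr dr lip cS uS cg bd sd i.
  have <- : partial_y (betahat rho g) i z = 'd (beta rho g) z (delta_mx i 0, 0) by rewrite /partial_y deriveE.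
  suff -> : (X *m J) i i = (z.2 *m partial_y (betahat rho g) i z) i 0 by [].
  by rewrite !mxE; apply: eq_bigr => j _; rewrite mxE.
have dfE : df = \tr (X *m A *m X^T *m D) by rewrite /df JE !mulmxA.
have VE : V = D - D *m X *m A *m X^T *m D by rewrite /V mulmxBr mulmx1 JE !mulmxA.
have sub1 (M : 'M[R]_n.+1) i : (1%:M - M) i i = 1 - M i i by rewrite !mxE eqxx.
have Vii i : V i i = dd i * (1 - (X *m J) i i).
  rewrite /V DE mul_diag_mx [LHS]mxE [(\row_ _ _) _ _]mxE.
  by rewrite sub1.
split => //; split.
  rewrite /df /mxtrace; apply/andP; split.
    by apply: sumr_ge0 => i _; have /andP[] := lev i.
  rewrite -[n.+1 in leRHS]card_ord -sumr_const; apply: ler_sum => i _.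
  by have /andP[] := lev i.
rewrite /mxtrace; apply/andP; split.
  apply: sumr_ge0 => i _; rewrite Vii; have /andP[h1 _] := dd01 i; have /andP[_ h2] := lev i.
  by rewrite mulr_ge0// subr_ge0.
rewrite -[n.+1 in leRHS]card_ord -sumr_const; apply: ler_sum => i _; rewrite Vii.
have /andP[h1 h2] := dd01 i; have /andP[h3 h4] := lev i.
by rewrite -[leRHS]mulr1 ler_pM// ?subr_ge0// lerBlDr lerDl.
Qed.

Theorem theorem1 (R : realType) (n p : nat) (hn : (1 <= n)%N) (hp : (1 <= p)%N)
  (gamma mu : R) (hgamma : 0 < gamma) (hmu : 0 < mu)
  (hpn : p%:R / n%:R <= gamma)
  (rho : R -> R)
  (rho_convex : convex_function [set: R^o] (rho : R^o -> R^o))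
  (rho_min : forall u : R, u != 0 -> rho 0 < rho u)
  (rho_derivable : forall u : R, derivable rho u 1)
  (rho_C1 : continuous (derive1 rho))
  (psi_lip : (1 : R).-lipschitz (derive1 rho : R^o -> R^o))
  (Sigma : 'M[R]_p) (Sigma_cov : is_covariance Sigma)
  (Sigma_unit : Sigma \in unitmx)
  (g : 'cV[R]_p -> R)
  (g_convex : convex_function [set: 'cV[R]_p]
     ((fun b : 'cV[R]_p => g b - mu / 2 * (b^T *m Sigma *m b) 0 0)
        : 'cV[R]_p -> R^o)) :
  lebesgue_ae (fun z : 'cV[R]_n * 'M[R]_(n, p) =>
    differentiable (betahat rho g) z /\
    exists A : 'M[R]_p,
      let X := z.2 in
      let psi := derive1 rho in
      let b := betahat rho g z in
      let r := z.1 - X *m b in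
      let D := diag_of (map_mx (derivative_or0 psi) r) in
      let J := jacobian_y (betahat rho g) z in
      let df := \tr (X *m J) in
      let V := D *m (1%:M - X *m J) in
      [/\ opnorm (psd_sqrt Sigma *m A *m psd_sqrt Sigma) <= (n%:R * mu)^-1,
          forall i : 'I_n,
            partial_y (betahat rho g) i z =
              derivative_or0 psi (r i 0) *: (A *m X^T *m delta_mx i 0),
          forall (i : 'I_n) (j : 'I_p),
            partial_x (betahat rho g) i j z =
              psi (r i 0) *: (A *m delta_mx j 0)
              - (derivative_or0 psi (r i 0) * b j 0) *: (A *m X^T *m delta_mx i 0),
          df = \tr (X *m A *m X^T *m D) /\
          V = D - D *m X *m A *m X^T *m D &
          0 <= df <= n%:R /\ 0 <= \tr V <= n%:R]).
Proof.
case: n hn hpn => // n _ _.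
have cr := convex_functionE rho_convex.
have cg := convex_functionE g_convex.
have lip u v : `|derive1 rho u - derive1 rho v| <= `|u - v|.
  by have := psi_lip (u, v) (conj Logic.I Logic.I); rewrite /= mul1r.
have [K hK] := beta_lip_ball (ltn0Sn n) hmu cr rho_derivable lip Sigma_cov Sigma_unit cg.
pose bad (x : 'I_p + 'I_n.+1) : set ('cV[R]_n.+1 * 'M[R]_(n.+1, p)) :=
  match x with
  | inl j => [set z | ~ differentiable (fun w => betahat rho g w j 0) z]
  | inr i => [set z | ~ differentiable (fun w => score rho g w i) z]
  end.
rewrite /lebesgue_ae; apply/eqP; rewrite eq_le lebesgue_outer_ge0 andbT.
have <- : lebesgue_outer (\bigcup_x bad x) = 0%E.
  apply: outer_null_bigcup => [|[j|i]]; first exact: countableP.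
    apply: (rademacher_local (K := K)) => M z w zM wM.
    have [h _] := hK M z w zM wM; apply: le_trans h.
    have := col_norm (beta rho g z - beta rho g w) j.
    by rewrite !mxE.
  apply: (rademacher_local (K := K)) => M z w zM wM.
  by have [_ ] := hK M z w zM wM; exact.
apply: le_lebesgue_outer => z /=; apply: contra_notP => good.
have bd j : differentiable (fun w => betahat rho g w j 0) z.
  by apply: contrapT => h; apply: good; exists (inl j).
have sd i : differentiable (fun w => score rho g w i) z.
  by apply: contrapT => h; apply: good; exists (inr i).
have dbeta : differentiable (betahat rho g) z by exact: differentiable_entries.
by split => //; exact: sensitivity_formulas hmu cr rho_derivable lip Sigma_cov Sigma_unit cg dbeta sd.
Qed.
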